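(* Consider a finite discounted MDP and the tabular 2RA Q-learning iteration with $N\in\mathbb{N}$ estimates $\theta^{(1)}_n,\dots,\theta^{(N)}_n\in\mathbb{R}^{|\mathcal X|}$ and iteration-dependent regularization parameters $\rho_n$, as defined in the context (so $d=|\mathcal X|$ and $\Phi$ is the canonical basis). Let $\{\rho_n\}_{n\in\mathbb{N}}$ be a sequence of non-negative numbers with $\lim_{n\to\infty}\rho_n=0$. Assume that (i) the learning rates satisfy, for every $(s,a)\in\mathcal S\times\mathcal A$: $\alpha_n(s,a)\in(0,1]$ if $(s,a)=(S_n,A_n)$, $\alpha_n(s,a)=0$ if $(s,a)\ne(S_n,A_n)$, $\sum_{n=0}^\infty\alpha_n(s,a)=\infty$ and $\sum_{n=0}^\infty\alpha_n^2(s,a)<\infty$ ($\mathbb{P}$-almost surely); (ii) the reward function $r$ is bounded. Then, for any $N\in\mathbb{N}$, 2RA Q-learning converges to the optimal Q-function $Q^\star$: $$\lim_{n\to\infty}\Phi^\top\widehat\theta_{N,n}=Q^\star\qquad\mathbb{P}\text{-almost surely},$$ where $\widehat\theta_{N,n}=\frac1N\sum_{i=1}^N\theta_n^{(i)}$.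
   Context: MDP: finite state space $\mathcal S$, finite action space $\mathcal A$, transition kernel $P(s'|s,a)$, reward $r:\mathcal S\times\mathcal A\to\mathbb{R}$, discount factor $\gamma\in(0,1)$, deterministic initial state $s_0$. Put $\mathcal X=\mathcal S\times\mathcal A$. The optimal Q-function $Q^\star:\mathcal X\to\mathbb{R}$ is the unique solution of the Bellman equation $$Q^\star(s,a)=r(s,a)+\gamma\sum_{s'\in\mathcal S}P(s'|s,a)\max_{a'\in\mathcal A}Q^\star(s',a')\quad\forall (s,a)\in\mathcal X.$$ Data: a single trajectory $X_n=(S_n,A_n)$, $n\ge0$, with $S_0=s_0$, generated by a fixed stationary behavioral policy $\pi$: $A_n\sim\pi(\cdot|S_n)$ and $S_{n+1}\sim P(\cdot|S_n,A_n)$. $\mathbb{P}$ denotes the underlying probability measure. Features: $\phi(s,a)\in\mathbb{R}^d$, $\Phi=(\phi(x))_{x\in\mathcal X}\in\mathbb{R}^{d\times|\mathcal X|}$. Tabular setting: $d=|\mathcal X|$ and $\phi(x)$ is the canonical unit vector of $\mathbb{R}^{|\mathcal X|}$ associated with $x$ (so $\Phi$ is the identity, and a vector in $\mathbb{R}^{|\mathcal X|}$ is identified with a function on $\mathcal X$). 2RA Q-learning: for $i=1,\dots,N$, $$\theta^{(i)}_{n+1}=\theta^{(i)}_n+\alpha_n\beta_n^{(i)}\big(b(X_n)-A_1(X_n)\theta_n^{(i)}+\mathcal E_{\rho_n}(X_n,S_{n+1},\widehat\theta_{N,n})\big),$$ where $\alpha_n=\alpha_n(S_n,A_n)$, $b(x)=\phi(x)r(x)$,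 $A_1(x)=\phi(x)\phi(x)^\top$, $\widehat\theta_{N,n}=\frac1N\sum_{i=1}^N\theta^{(i)}_n$, and $$\mathcal E_\rho(x,s',\theta)=\gamma\,\phi(x)\max_{a'\in\mathcal A}\ \min_{\theta'\in\mathbb{R}^d:\ \|\theta-\theta'\|_2^2\le\rho}\phi(s',a')^\top\theta'.$$ The $\beta_n=(\beta_n^{(1)},\dots,\beta_n^{(N)})$ are i.i.d. with $\mathbb{P}(\beta_n=e_i)=1/N$ for $i=1,\dots,N$, where $e_i$ is the $i$-th unit vector of $\mathbb{R}^N$. The initial vectors $\theta_0^{(i)}$ are arbitrary. Conventions: let $\mathcal G_n$ be the $\sigma$-field generated by the initial vectors $\theta_0^{(i)}$, $S_0,A_0,\dots,S_n,A_n$, $\alpha_0,\dots,\alpha_n$ and $\beta_0,\dots,\beta_{n-1}$. The learning rates (possibly random) are non-anticipating: conditionally on $\mathcal G_n$, $S_{n+1}$ has law $P(\cdot|S_n,A_n)$, and $\beta_n$ is independent of $(\mathcal G_n,S_{n+1})$. *)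

(* Defs.v *)
From HB Require Import structures.
From mathcomp Require Import all_boot all_order all_algebra.
From mathcomp Require Import all_classical all_reals all_analysis.
Set Implicit Arguments.
Unset Strict Implicit.
Unset Printing Implicit Defensive.
Import Order.TTheory GRing.Theory Num.Theory.
Import numFieldNormedType.Exports.
Local Open Scope classical_set_scope.
Local Open Scope ring_scope.

(* [sup] is only used over a finite nonempty type, where it is a maximum:
   see [maxf_attained] and [maxf_ge]. *)
Definition maxf (R : realType) (T : finType) (f : T -> R) : R := sup (range f).

Lemma maxf_attained (R : realType) (T : finType) (f : T -> R) (t0 : T) :
  exists t, maxf f = f t /\ forall t', f t' <= f t.
Proof.
exists [arg max_(t > t0) f t]%O.
case: arg_maxP => // t _ Ht; split; last by move=> t'; exact: Ht.
apply/eqP; rewrite eq_le; apply/andP; split.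
  by apply: ge_sup; [exists (f t), t | move=> _ [t' _ <-]; exact: Ht].
by apply: ub_le_sup; [exists (f t) => _ [t' _ <-]; exact: Ht | exists t].
Qed.

Lemma maxf_ge (R : realType) (T : finType) (f : T -> R) (t : T) :
  f t <= maxf f.
Proof. by have [u [-> ->]] := maxf_attained f t. Qed.

Section MDP.
Context {R : realType} {S A : finType}.

Definition is_kernel (U T : finType) (K : U -> T -> R) : Prop :=
  (forall u t, 0 <= K u t) /\ (forall u, \sum_t K u t = 1).

Definition bellman_op (P : S * A -> S -> R) (r : S * A -> R) (gamma : R)
    (Q : S * A -> R) : S * A -> R :=
  fun x => r x + gamma * \sum_s' P x s' * maxf (fun a' => Q (s', a')).

Definition is_Qstar (P : S * A -> S -> R) (r : S * A -> R) (gamma : R)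
    (Q : S * A -> R) : Prop :=
  forall x, Q x = bellman_op P r gamma Q x.

Definition vec_of_fun (Q : S * A -> R) : 'cV[R]_#|{: S * A}| :=
  \col_j Q (enum_val j).

End MDP.

Lemma maxf_dist (R : realType) (T : finType) (f g : T -> R) (e : R) (t0 : T) :
  (forall t, `|f t - g t| <= e) -> `|maxf f - maxf g| <= e.
Proof.
move=> fg; have [u [-> fu]] := maxf_attained f t0.
have [v [-> gv]] := maxf_attained g t0.
rewrite ler_norml; apply/andP; split.
  have := fg v; rewrite ler_norml => /andP[+ _] => /le_trans; apply.
  by rewrite lerB.
have := fg u; rewrite ler_norml => /andP[_]; apply: le_trans.
by rewrite lerB.
Qed.

Lemma bellman_op_contract (R : realType) (S A : finType) (P : S * A -> S -> R)
    (r : S * A -> R) (gamma e : R) (Q Q' : S * A -> R) :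
  is_kernel P -> 0 <= gamma -> (forall x, `|Q x - Q' x| <= e) ->
  forall x, `|bellman_op P r gamma Q x - bellman_op P r gamma Q' x|
     <= gamma * e.
Proof.
move=> [P0 P1] g0 QQ [s a]; rewrite /bellman_op opprD addrACA subrr add0r.
rewrite -mulrBr normrM (ger0_norm g0) ler_wpM2l// -sumrB.
apply: le_trans (ler_norm_sum _ _ _) _.
rewrite -[e]mul1r -(P1 (s, a)) mulr_suml; apply: ler_sum => s' _.
rewrite -mulrBr normrM (ger0_norm (P0 _ _)) ler_wpM2l//.
exact: maxf_dist.
Qed.

Lemma Qstar_exists_unique (R : realType) (S A : finType)
    (P : S * A -> S -> R) (r : S * A -> R) (gamma : R) :
  is_kernel P -> 0 < gamma < 1 -> exists! Q, is_Qstar P r gamma Q.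
Proof.
move=> Pk /andP[g0 g1].
pose T (v : 'cV[R]_#|{: S * A}|) :=
  vec_of_fun (bellman_op P r gamma (fun x => v (enum_rank x) 0)).
have TT v : [set: 'cV[R]_#|{: S * A}|] v -> [set: 'cV[R]_#|{: S * A}|] (T v).
  by [].
pose F : {fun [set: 'cV[R]_#|{: S * A}|] >-> [set: 'cV[R]_#|{: S * A}|]} :=
  mkfun_fun TT.
pose V : completeNormedModType R := HB.pack 'cV[R]_#|{: S * A}|
  (NormedModule.on 'cV[R]_#|{: S * A}|) (Complete.on 'cV[R]_#|{: S * A}|).
have ctr : is_contraction F.
  exists (NngNum (ltW g0)); split => //= -[u v] _ /=.
  rewrite {1}/Num.norm/= mx_normrE; apply/bigmax_leP; split.
    by apply: mulr_ge0; [exact: ltW|exact: normr_ge0].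
  move=> [i j] _ /=; rewrite !mxE.
  apply: bellman_op_contract => //; first exact: ltW.
  move=> x; rewrite {2}/Num.norm/= mx_normrE.
  by apply/bigmax_geP; right; exists (enum_rank x, 0) => //=; rewrite !mxE.
have [q _ qE] := @banach_fixed_point R V setT F ctr closedT (ex_intro _ 0 I).
pose Q x := q (enum_rank x) 0.
have QP : is_Qstar P r gamma Q.
  by move=> x; rewrite {1}/Q qE /= mxE enum_rankK.
exists Q; split=> // Q' Q'P.
have dec n x : `|Q x - Q' x| <= gamma ^+ n * \sum_y `|Q y - Q' y|.
  elim: n x => [|n IH] x.
    by rewrite mul1r (bigD1 x)//= lerDl sumr_ge0.
  by rewrite QP Q'P exprS -mulrA; apply: bellman_op_contract => //; exact: ltW.
apply/funext => x; apply/eqP; rewrite -subr_eq0 -normr_eq0 eq_le normr_ge0 andbT.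
have h : (gamma ^+ n * \sum_y `|Q y - Q' y|) @[n --> \oo] --> (0 : R).
  rewrite -[X in _ --> X](mul0r (\sum_y `|Q y - Q' y|)).
  by apply: cvgMl; apply: cvg_expr; rewrite ger0_norm// ltW.
by apply: (cvgr_to_ge h); apply: nearW => n; exact: dec.
Qed.

Section Algorithm.
Context {R : realType} {S A : finType}.

Definition norm2sq (d : nat) (v : 'cV[R]_d) : R := \sum_i v i 0 ^+ 2.

Definition dotv (d : nat) (u v : 'cV[R]_d) : R := (u^T *m v) 0 0.

(* The infimum is over a nonempty compact set, hence is a minimum; for the
   tabular features see [worst_value_tabular]. *)
Definition worst_value (d : nat) (v : 'cV[R]_d) (rho : R)
    (theta : 'cV[R]_d) : R :=
  inf [set dotv v theta' | theta' in
        [set theta' : 'cV[R]_d | norm2sq (theta - theta') <= rho]].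

Section Features.
Variables (d : nat) (phi : S * A -> 'cV[R]_d).

Definition feature_mx : 'M[R]_(d, #|{: S * A}|) :=
  \matrix_(i, j) phi (enum_val j) i 0.

Definition bvec (r : S * A -> R) (x : S * A) : 'cV[R]_d := r x *: phi x.

Definition A1mx (x : S * A) : 'M[R]_d := phi x *m (phi x)^T.

Definition reg_term (gamma rho : R) (x : S * A) (s' : S)
    (theta : 'cV[R]_d) : 'cV[R]_d :=
  (gamma * maxf (fun a' => worst_value (phi (s', a')) rho theta)) *: phi x.

Definition average (N : nat) (theta : 'I_N -> 'cV[R]_d) : 'cV[R]_d :=
  N%:R^-1 *: \sum_i theta i.

Section Iteration.
Variables (r : S * A -> R) (gamma : R) (rho : nat -> R) (Omega : Type).
Variables (Sn : nat -> Omega -> S) (An : nat -> Omega -> A).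
Variables (alpha : nat -> S * A -> Omega -> R) (N : nat).
Variables (beta : nat -> Omega -> 'rV[R]_N) (theta0 : 'I_N -> Omega -> 'cV[R]_d).

Fixpoint twoRA (n : nat) (i : 'I_N) (w : Omega) : 'cV[R]_d :=
  if n is m.+1 then
    let x := (Sn m w, An m w) in
    twoRA m i w + (alpha m x w * beta m w 0 i) *:
      (bvec r x - A1mx x *m twoRA m i w
       + reg_term gamma (rho m) x (Sn m.+1 w) (average (fun j => twoRA m j w)))
  else theta0 i w.

Definition theta_hat (n : nat) (w : Omega) : 'cV[R]_d :=
  average (fun i => twoRA n i w).

End Iteration.
End Features.

Definition tabular (x : S * A) : 'cV[R]_#|{: S * A}| :=
  delta_mx (enum_rank x) 0.

Lemma worst_value_tabular (x : S * A) (rho : R)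
    (theta : 'cV[R]_#|{: S * A}|) : 0 <= rho ->
  exists theta', norm2sq (theta - theta') <= rho /\
    worst_value (tabular x) rho theta = dotv (tabular x) theta' /\
    forall theta'', norm2sq (theta - theta'') <= rho ->
      dotv (tabular x) theta' <= dotv (tabular x) theta''.
Proof.
move=> rho0; set k := enum_rank x.
have dotE v : dotv (tabular x) v = v k 0.
  rewrite /dotv /tabular -/k mxE (bigD1 k)//= !mxE !eqxx mul1r big1 ?addr0//.
  by move=> j jk; rewrite !mxE (negbTE jk) mul0r.
pose th := theta - Num.sqrt rho *: tabular x.
have thk : th k 0 = theta k 0 - Num.sqrt rho.
  by rewrite /th /tabular !mxE !eqxx mulr1.
have thP : norm2sq (theta - th) <= rho.
  rewrite /norm2sq /th subKr (bigD1 k)//= big1 ?addr0.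
    by rewrite !mxE !eqxx mulr1 sqr_sqrtr.
  by move=> j jk; rewrite !mxE (negbTE jk) mulr0 expr0n.
have minP v : norm2sq (theta - v) <= rho -> th k 0 <= v k 0.
  move=> hv; rewrite thk lerBlDr -lerBlDl.
  apply: le_trans (ler_norm _) _; rewrite -sqrtr_sqr ler_sqrt//.
  apply: le_trans hv; rewrite /norm2sq (bigD1 k)//= !mxE lerDl.
  by apply: sumr_ge0 => j _; exact: sqr_ge0.
exists th; split=> //; split; last by move=> v /minP; rewrite !dotE.
apply/eqP; rewrite eq_le; apply/andP; split.
  apply: ge_inf; last by exists th.
  by exists (th k 0) => _ [v /minP hv <-]; rewrite dotE.
apply: lb_le_inf; first by exists (dotv (tabular x) th), th.
by move=> _ [v /minP hv <-]; rewrite !dotE.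
Qed.

End Algorithm.

Section Probability.
Context {R : realType} {d : measure_display} {Omega : measurableType d}.

Definition events_fin (T : finType) (Y : Omega -> T) : set (set Omega) :=
  preimage_set_system setT Y setT.

Definition events_real (Y : Omega -> R) : set (set Omega) :=
  preimage_set_system setT Y measurable.

Definition events_mx (m n : nat) (Y : Omega -> 'M[R]_(m, n)) :
    set (set Omega) :=
  <<s \bigcup_ij events_real (fun w => Y w ij.1 ij.2) >>.

Definition measurable_events (events : set (set Omega)) : Prop :=
  events `<=` (measurable : set (set Omega)).

Definition cond_law (Pr : probability Omega R) (F : set (set Omega))
    (T : finType) (Y : Omega -> T) (mu : Omega -> T -> R) : Prop :=
  forall E t, F E ->
    Pr (E `&` Y @^-1` [set t]) = (\int[Pr]_(w in E) (mu w t)%:E)%E.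

Definition independent_fields (Pr : probability Omega R)
    (F G : set (set Omega)) : Prop :=
  forall E E', F E -> G E' -> Pr (E `&` E') = (Pr E * Pr E')%E.

(* Events [E k = setT] are allowed, so initial segments suffice. *)
Definition independent_seq (Pr : probability Omega R)
    (F : nat -> set (set Omega)) : Prop :=
  forall (n : nat) (E : nat -> set Omega), (forall k, F k (E k)) ->
    Pr (\bigcap_(k in `I_n) E k) = (\prod_(k < n) Pr (E k))%E.

Section Filtration.
Context {S A : finType}.
Variables (Sn : nat -> Omega -> S) (An : nat -> Omega -> A).
Variables (alpha : nat -> S * A -> Omega -> R) (N m : nat).
Variables (beta : nat -> Omega -> 'rV[R]_N) (theta0 : 'I_N -> Omega -> 'cV[R]_m).

(* Information available when the action [An n] is drawn. *)
Definition history (n : nat) : set (set Omega) :=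
  <<s \bigcup_(k in `I_n.+1) events_fin (Sn k) `|`
      \bigcup_(k in `I_n) events_fin (An k) >>.

Definition Gfield (n : nat) : set (set Omega) :=
  <<s \bigcup_i events_mx (theta0 i) `|`
      \bigcup_(k in `I_n.+1)
        (events_fin (Sn k) `|` events_fin (An k) `|`
         \bigcup_x events_real (alpha k x)) `|`
      \bigcup_(k in `I_n) events_mx (beta k) >>.

Definition Gfield_next (n : nat) : set (set Omega) :=
  <<s Gfield n `|` events_fin (Sn n.+1) >>.

End Filtration.
End Probability.

(* Main.v *)
Require Import Defs.
From HB Require Import structures.
From mathcomp Require Import all_boot all_order all_algebra.
From mathcomp Require Import all_classical all_reals all_analysis.
From mathcomp Require Import measurable_realfun.
From mathcomp Require Import ring lra.
Import Order.TTheory GRing.Theory Num.Theory.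
Import numFieldNormedType.Exports.
Local Open Scope classical_set_scope.
Local Open Scope ring_scope.
Set Implicit Arguments.
Unset Strict Implicit.
Unset Printing Implicit Defensive.

(* Fix a sample path. Since [alpha <= 1] and [gamma < 1], the estimates stay
   bounded by a path-dependent constant. Each pair [(i, x)] follows a relaxation
     [D' = (1 - a) D + a (g + w + eps)], [a = alpha_n(x) beta_n^(i)],
   for [D = theta^(i)(x) - Qstar x], where [g] is at most [gamma] times the sup
   norm of all the [D], [eps = - gamma sqrt(rho_n)] vanishes, and [w] is the
   sampling noise of the next state. Asynchronous contraction gives [D --> 0] as
   soon as [sum a = +oo] and [sum a w] converges. Both are almost sure facts
   about series [sum c_k xi_k] with [c_k] adapted and square-summable and
   [xi_k] centered given the past, which converge by Kolmogorov's maximal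
   inequality (applied to a stopped sum) after truncating [c] at the first time
   the sum of squares exceeds a constant: take [xi = 1_(beta = e_i) - 1/N] for
   the divergence of [sum a], and the centered indicators of the next state,
   weighted by the greedy values, for the noise. *)

(** * Asynchronous relaxations *)

(** A hyperbolic substitute for the decay [exp (- sum a)]. Since [(1 - b) * (1 + s + b) = 1 + s - b
    * (s + b) <= 1 + s], the product of [z] with one plus the partial sum never increases. *)
Lemma relaxation_decay (R : realType) (a z : nat -> R) (n0 : nat) :
  (forall n, 0 <= a n <= 1) -> (forall n, 0 <= z n) ->
  (forall n, (n0 <= n)%N -> z n.+1 <= (1 - a n) * z n) ->
  forall k, z (n0 + k)%N * (1 + \sum_(n0 <= j < n0 + k) a j) <= z n0.
Proof.
move=> a01 z0 zS; elim=> [|k IH]; first by rewrite addn0 big_geq// addr0 mulr1.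
rewrite addnS big_nat_recr ?leq_addr//=; apply: le_trans IH.
set s := \sum_(_ <= _ < _) _; have s0 : 0 <= s.
  by apply: sumr_ge0 => j _; have /andP[] := a01 j.
have /andP[a0 a1] := a01 (n0 + k)%N.
have := zS _ (leq_addr k n0); have := z0 (n0 + k)%N.
move: (z _) (z _.+1) (a _) a0 a1 => y y' b b0 b1 y0 yS.
apply: (@le_trans _ _ ((1 - b) * y * (1 + (s + b)))).
  by rewrite ler_wpM2r//; lra.
have : 0 <= y * (b * s + b * b) by rewrite mulr_ge0// addr_ge0// mulr_ge0.
by nra.
Qed.

Definition diverges (R : realType) (a : nat -> R) :=
  forall K, exists n, K <= \sum_(0 <= j < n) a j.

(** The positive part of [y - H] obeys the homogeneous recursion, so [relaxation_decay] and
    divergence of [sum a] push it below [e]. *)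
Lemma relaxation_bound (R : realType) (a y : nat -> R) (H e : R) :
  (forall n, 0 <= a n <= 1) -> diverges a -> 0 < e ->
  (\forall n \near \oo, y n.+1 <= (1 - a n) * y n + a n * H) ->
  \forall n \near \oo, y n <= H + e.
Proof.
move=> a01 adiv e0 [n0 _ yS].
pose z n := Num.max 0 (y n - H).
have z0 n : 0 <= z n by rewrite le_max lexx.
have zS n : (n0 <= n)%N -> z n.+1 <= (1 - a n) * z n.
  move=> /yS /= h; have /andP[a0 a1] := a01 n.
  rewrite ge_max mulr_ge0 ?subr_ge0//=.
  apply: (@le_trans _ _ ((1 - a n) * (y n - H))); first by lra.
  by rewrite ler_wpM2l ?subr_ge0// le_max lexx orbT.
have hb := @relaxation_decay _ _ _ n0 a01 z0 zS.
(* The threshold leaves a sum of at least [z n0 / e] after the initial segment up to [n0] is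
   removed. *)
have [m hm] := adiv (\sum_(0 <= j < n0) a j + z n0 / e).
exists (n0 + m)%N => // n /= hn.
have n0n : (n0 <= n)%N by apply: leq_trans hn; exact: leq_addr.
have := hb (n - n0)%N; rewrite subnKC// => hz.
have mn : (m <= n)%N by apply: leq_trans hn; exact: leq_addl.
have hs : z n0 / e <= \sum_(n0 <= j < n) a j.
  rewrite -(lerD2l (\sum_(0 <= j < n0) a j)) -big_cat_nat//=.
  apply: le_trans hm _; rewrite [leRHS](big_cat_nat (leq0n _) mn)/= lerDl.
  by apply: sumr_ge0 => j _; have /andP[] := a01 j.
rewrite -lerBlDl; apply: (@le_trans _ _ (z n)).
  by rewrite le_max lexx orbT.
rewrite leNgt; apply/negP => ez.
(* The two sides are equal, so this strict inequality is the contradiction. *)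
have : e * (1 + z n0 / e) < z n0 + e.
  apply: (@lt_le_trans _ _ (z n * (1 + z n0 / e))).
    by rewrite ltr_pM2r// ltr_pwDl// divr_ge0// ltW.
  apply: le_trans (_ : z n0 <= _); last by lra.
  by apply: le_trans hz; rewrite ler_wpM2l// lerD2l.
by rewrite mulrDr mulr1 mulrCA divff ?gt_eqF// mulr1 addrC ltxx.
Qed.

(* [Y = D - (M - lim M)], with [M] the partial sums of [a * w], absorbs the
   noise: it obeys the same relaxation with [w] replaced by the vanishing
   [lim M - M]. *)
Lemma async_contraction_cvg0 (R : realType) (J : finType)
    (a w g eps D : J -> nat -> R) (gamma B : R) :
  0 <= gamma < 1 ->
  (forall j n, 0 <= a j n <= 1) -> (forall j, diverges (a j)) ->
  (forall j, cvgn (fun n => \sum_(0 <= k < n) a j k * w j k)) ->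
  (forall j, eps j @ \oo --> 0) ->
  (forall j n, `|D j n| <= B) ->
  (forall n (C : R), (forall j, `|D j n| <= C) ->
    forall j, `|g j n| <= gamma * C) ->
  (forall j n, D j n.+1 =
     (1 - a j n) * D j n + a j n * (g j n + w j n + eps j n)) ->
  forall j, D j @ \oo --> 0.
Proof.
move=> /andP[g0 g1] a01 adiv Mcvg eps0 DB gD DS.
pose M j n := \sum_(0 <= k < n) a j k * w j k.
pose Z j n : R := limn (M j) - M j n.
have Z0 j : Z j @ \oo --> 0.
  rewrite -(subrr (limn (M j))); apply: cvgB; first exact: cvg_cst.
  exact: Mcvg.
have near0 (f : J -> nat -> R) (e : R) : (forall j, f j @ \oo --> 0) -> 0 < e ->
    \forall n \near \oo, forall j, `|f j n| <= e.
  move=> f0 e0; apply: filter_forall => j.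
  have := f0 j => /cvgrPdist_le /(_ e e0); apply: filterS => n.
  by rewrite sub0r normrN.
have step (C e : R) : 0 < e -> (\forall n \near \oo, forall j, `|D j n| <= C) ->
    \forall n \near \oo, forall j, `|D j n| <= gamma * C + e.
  move=> e0 hC; apply: filter_forall => j.
  (* The four quarters of [e] pay for [eps], for [Z] inside the recursion, for the slack of
     [relaxation_bound], and for the return from [Y] to [D]. *)
  have e4 : 0 < e / 4 by rewrite divr_gt0.
  pose Y n := D j n + Z j n.
  have hY : \forall n \near \oo, `|Y n| <= (gamma * C + e / 4 + e / 4) + e / 4.
    apply: (@relaxation_bound _ (a j)) => //.
    have nZ := near0 Z _ Z0 e4; have ne := near0 eps _ eps0 e4.
    near=> n.
    have -> : Y n.+1 = (1 - a j n) * Y n + a j n * (g j n + eps j n + Z j n).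
      by rewrite /Y DS /Z /M big_nat_recr//=; ring.
    have /andP[aj0 aj1] := a01 j n.
    apply: le_trans (ler_normD _ _) _; rewrite !normrM.
    rewrite (ger0_norm aj0) (@ger0_norm _ (1 - a j n)) ?subr_ge0//.
    rewrite lerD2l ler_wpM2l//.
    apply: le_trans (ler_normD _ _) _; apply: lerD; last first.
      by near: n; move: nZ; apply: filterS => k /(_ j).
    apply: le_trans (ler_normD _ _) _; apply: lerD; last first.
      by near: n; move: ne; apply: filterS => k /(_ j).
    apply: (gD n); near: n; exact: hC.
  near=> n.
  have -> : D j n = Y n - Z j n by rewrite /Y addrK.
  apply: le_trans (ler_normB _ _) _.
  have h1 : `|Y n| <= (gamma * C + e / 4 + e / 4) + e / 4 by near: n.
  have h2 : `|Z j n| <= e / 4.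
    by near: n; have := near0 Z _ Z0 e4; apply: filterS => k /(_ j).
  by lra.
have iter (e : R) k : 0 < e ->
    \forall n \near \oo, forall j, `|D j n| <= e / 2 + gamma ^+ k * B.
  move=> e0; elim: k => [|k IH].
    apply: nearW => n j; rewrite expr0 mul1r.
    by apply: le_trans (DB j n) _; rewrite lerDr; lra.
  (* With this slack, [C |-> gamma * C + slack] fixes [e / 2], so the excess [gamma ^+ k * B] alone
     is multiplied by [gamma]. *)
  have := step _ ((1 - gamma) * e / 2) _ IH; rewrite exprS.
  have e1 : 0 < (1 - gamma) * e / 2 by rewrite divr_gt0// mulr_gt0// subr_gt0.
  move=> /(_ e1); apply: filterS => n h j; apply: le_trans (h j) _.
  by rewrite -mulrA; lra.
move=> j; apply/cvgrPdist_le => e e0.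
have /cvgrPdist_le /(_ (e / 2) (divr_gt0 e0 (ltr0Sn _ _))) [k _ hk] :
    (gamma ^+ k * B) @[k --> \oo] --> 0.
  rewrite -(mul0r B); apply: cvgMl.
  by apply: cvg_expr; rewrite ger0_norm.
have := hk k (leqnn k); rewrite /= sub0r normrN => hk'.
have := iter e k e0; apply: filterS => n /(_ j) h.
rewrite sub0r normrN; apply: le_trans h _.
by have := ler_norm (gamma ^+ k * B); lra.
Unshelve. all: by end_near.
Qed.

(** * Almost sure convergence of square-summable martingale transforms *)

(** The generated sigma-algebra is made a measurable type of its own, so that the closure lemmas for
    [measurable_fun] apply to it directly. *)
Definition adapted (R : realType) (Omega : pointedType) (G : set (set Omega))
    (f : Omega -> R) :=
  measurable_fun [set: g_sigma_algebraType G]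
    (f : g_sigma_algebraType G -> R).

Section Martingale.
Context (R : realType) (d : measure_display) (Omega : measurableType d)
  (Pr : probability Omega R).

(** Moves the domain of integration into the measure, which can then be pushed forward to a smaller
    sigma-algebra. *)
Lemma ge0_integral_mrestr (A : set Omega) (mA : measurable A)
    (f : Omega -> \bar R) :
  measurable_fun setT f -> (forall w, 0 <= f w)%E ->
  (\int[mrestr Pr mA]_w f w = \int[Pr]_(w in A) f w)%E.
Proof.
move=> mf f0.
rewrite (@ge0_negligible_integral _ _ _ _ _ (~` A)) //=.
- rewrite setTD setCK; apply: eq_measure_integral => B mB BA.
  by rewrite /mrestr/=; congr (Pr _); apply/setIidl.
- exact: measurableC.
- by rewrite /mrestr/= setICl measure0.
Qed.

(** * Centered indicators tested against weights known from the past *)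

Section Centered.
Context (G : set (set Omega)).
Hypothesis Gm : <<s G>> `<=` measurable.

Lemma adapted_measurable (f : Omega -> R) :
  adapted G f -> measurable_fun setT f.
Proof. by move=> mf mT Y mY; apply: Gm; exact: (mf measurableT Y mY). Qed.

(** On the sigma-algebra generated by [G], [Pr] restricted to [A] and [p] times [Pr] restricted to
    [B] are the same measure, hence integrate [Z] alike. *)
Lemma ge0_integral_proportional (A B : set Omega) (p : R) (Z : Omega -> R) :
  measurable A -> measurable B -> 0 <= p ->
  (forall E, <<s G>> E -> Pr (E `&` A) = (p%:E * Pr (E `&` B))%E) ->
  adapted G Z -> (forall w, 0 <= Z w) ->
  (\int[Pr]_(w in A) (Z w)%:E = p%:E * \int[Pr]_(w in B) (Z w)%:E)%E.
Proof.
move=> mA mB p0 AB mZ Z0.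
(* Pushing a measure forward along this identity map restricts it to the sigma-algebra generated by
   [G]. *)
pose phi : Omega -> g_sigma_algebraType G := fun w => w.
have mphi : measurable_fun setT phi by move=> _ Y mY; rewrite setTI; exact: Gm.
have mZ' : measurable_fun [set: g_sigma_algebraType G]
    (fun w : g_sigma_algebraType G => (Z w)%:E) by exact/measurable_EFinP.
have push (C : set Omega) (mC : measurable C) :
    (\int[Pr]_(w in C) (Z w)%:E =
     \int[pushforward (mrestr Pr mC) phi]_w (Z w)%:E)%E.
  rewrite -(ge0_integral_mrestr mC) //; last first.
    by apply/measurable_EFinP; exact: adapted_measurable.
  rewrite ge0_integral_pushforward //.
  by move=> w _; rewrite lee_fin.
rewrite !push -[p]/((NngNum p0)%:num).
rewrite -ge0_integral_mscale//; last by move=> w _; rewrite lee_fin.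
apply: eq_measure_integral => E mE _.
by rewrite /mscale/= /pushforward /mrestr/=; exact: AB.
Qed.

Lemma bounded_integrable (f : Omega -> R) (D : set Omega) :
  measurable D -> measurable_fun setT f -> (exists K, forall w, `|f w| <= K) ->
  Pr.-integrable D (EFin \o f).
Proof.
move=> mD mf [K fK]; apply: measurable_bounded_integrable => //.
- by apply: le_lt_trans (probability_le1 _ mD) _; rewrite ltry.
- exact: measurable_funS mf.
- exists K; split; first exact: num_real.
  by move=> M KM w _; exact: le_trans (ltW KM).
Qed.

(** Expresses that [\1_A - p * \1_B] has conditional mean zero given [G], without forming a
    conditional expectation: it is orthogonal to every bounded adapted [Z]. *)
Lemma Rintegral_proportional (A B : set Omega) (p : R) (Z : Omega -> R) :
  measurable A -> measurable B -> 0 <= p ->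
  (forall E, <<s G>> E -> Pr (E `&` A) = (p%:E * Pr (E `&` B))%E) ->
  adapted G Z -> (exists K, forall w, `|Z w| <= K) ->
  \int[Pr]_w (Z w * (\1_A w - p * \1_B w)) = 0.
Proof.
move=> mA mB p0 AB mZ [K ZK].
have mZ' := adapted_measurable mZ.
have main (Y : Omega -> R) : adapted G Y -> (exists K, forall w, `|Y w| <= K) ->
    (forall w, 0 <= Y w) -> \int[Pr]_w (Y w * (\1_A w - p * \1_B w)) = 0.
  move=> mY Yb Y0; have mY' := adapted_measurable mY.
  have Yi C : measurable C -> \int[Pr]_w (Y w * \1_C w) = \int[Pr]_(w in C) Y w.
    by move=> mC; rewrite [RHS]Rintegral_mkcond patch_indic.
  have Ib (C : set Omega) : measurable C ->
      Pr.-integrable setT (EFin \o (fun w => Y w * \1_C w)).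
    move=> mC; apply: bounded_integrable => //.
      by apply: measurable_funM => //; exact: measurable_indic.
    have [M YM] := Yb; exists M => w; rewrite normrM; apply: le_trans (YM w).
    by rewrite indicE ler_piMr// normr_nat lern1 leq_b1.
  under eq_Rintegral do rewrite mulrBr mulrCA.
  rewrite RintegralB//; last 2 first.
  - exact: Ib.
  - have := integrableZl measurableT p (Ib _ mB).
    by apply: eq_integrable => // w _.
  rewrite RintegralZl//; last exact: Ib.
  rewrite !Yi// /Rintegral (ge0_integral_proportional mA mB p0 AB mY Y0).
  rewrite fineM ?subrr//.
  have h := bounded_integrable mB mY' Yb.
  exact: integrable_fin_num h.
have mx : measurable_fun setT (fun w => \1_A w - p * \1_B w : R).
  apply: measurable_funB; first exact: measurable_indic.
  by apply: measurable_funM => //; exact: measurable_indic.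
have xb w : `|\1_A w - p * \1_B w : R| <= 1 + p.
  apply: le_trans (ler_normB _ _) _; apply: lerD.
    by rewrite indicE normr_nat lern1 leq_b1.
  by rewrite normrM (ger0_norm p0) ler_piMr// indicE normr_nat lern1 leq_b1.
have K0 : 0 <= K by apply: le_trans (ZK point).
(* A signed [Z] is the difference of [Z + K] and [K], both nonnegative, bounded and adapted. *)
transitivity (\int[Pr]_w ((Z w + K) * (\1_A w - p * \1_B w)) -
              \int[Pr]_w (K * (\1_A w - p * \1_B w))).
  rewrite -RintegralB//.
  - by apply: eq_Rintegral => w _; ring.
  - apply: bounded_integrable => //.
      by apply: measurable_funM => //; exact: measurable_funD.
    exists ((K + K) * (1 + p)) => w; rewrite normrM ler_pM//.
    apply: le_trans (ler_normD _ _) _; rewrite lerD//.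
    by rewrite (ger0_norm K0).
  - apply: bounded_integrable => //; first exact: measurable_funM.
    by exists (K * (1 + p)) => w; rewrite normrM (ger0_norm K0) ler_wpM2l.
rewrite !main ?subrr//.
- exact: measurable_cst.
- by exists `|K|.
- exact: measurable_funD.
- exists (K + `|K|) => w; apply: le_trans (ler_normD _ _) _.
  by rewrite lerD2r.
- by move=> w; have := ZK w; rewrite ler_norml => /andP[]; lra.
Qed.

End Centered.

(** * Transforms of centered indicators and their second moments *)

Section Process.
Context (G : nat -> set (set Omega)) (A B : nat -> set Omega) (p : nat -> R).
Hypothesis Gm : forall n, <<s G n>> `<=` measurable.
Hypothesis GS : forall n, <<s G n>> `<=` <<s G n.+1>>.
Hypothesis mA : forall n, <<s G n.+1>> (A n).
Hypothesis mB : forall n, <<s G n.+1>> (B n).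
Hypothesis p01 : forall n, 0 <= p n <= 1.
Hypothesis AB : forall n E, <<s G n>> E ->
  Pr (E `&` A n) = ((p n)%:E * Pr (E `&` B n))%E.

(** A martingale difference, centered given [G n] by [AB]. The event [B n] is only required to be
    known at time [n.+1], so it may involve the draw [beta n]. *)
Definition noise n w : R := \1_(A n) w - p n * \1_(B n) w.

Definition transform (c : nat -> Omega -> R) n w : R :=
  \sum_(0 <= k < n) c k w * noise k w.

Definition bounded_adapted (c : nat -> Omega -> R) :=
  forall n, adapted (G n) (c n) /\ exists K, forall w, `|c n w| <= K.

Lemma noise_bound n w : `|noise n w| <= 1.
Proof.
have /andP[p0 p1] := p01 n.
rewrite /noise !indicE ler_norml.
by case: (_ \in _); case: (_ \in _) => /=; rewrite ?mulr1n ?mulr0n;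
  apply/andP; split; lra.
Qed.

Lemma adaptedS n (f : Omega -> R) : adapted (G n) f -> adapted (G n.+1) f.
Proof. by move=> mf mT Y mY; apply: GS; exact: mf. Qed.

Lemma adapted_noise n : adapted (G n.+1) (noise n).
Proof.
apply: measurable_funB; first by apply: measurable_indic; exact: mA.
by apply: measurable_funM => //; apply: measurable_indic; exact: mB.
Qed.

Lemma transformS c n w :
  transform c n.+1 w = transform c n w + c n w * noise n w.
Proof. by rewrite /transform big_nat_recr. Qed.

Lemma adapted_transform c : bounded_adapted c ->
  forall n, adapted (G n) (transform c n).
Proof.
move=> hc; elim=> [|n IH].
  have -> : transform c 0 = cst 0.
    by apply/funext => w; rewrite /transform big_geq.
  exact: measurable_cst.
have -> : transform c n.+1 = (fun w => transform c n w + c n w * noise n w).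
  by apply/funext => w; exact: transformS.
apply: measurable_funD; first exact: adaptedS.
apply: measurable_funM; last exact: adapted_noise.
by apply: adaptedS; have [] := hc n.
Qed.

Lemma transform_bound c : bounded_adapted c ->
  forall n, exists K, forall w, `|transform c n w| <= K.
Proof.
move=> hc; elim=> [|n [K hK]].
  by exists 0 => w; rewrite /transform big_geq// normr0.
have [_ [L hL]] := hc n.
exists (K + L) => w; rewrite transformS; apply: le_trans (ler_normD _ _) _.
apply: lerD => //; rewrite normrM; apply: le_trans (hL w).
by rewrite ler_piMr// noise_bound.
Qed.

Lemma sqr_integrable n (f : Omega -> R) : adapted (G n) f ->
  (exists K, forall w, `|f w| <= K) ->
  Pr.-integrable setT (EFin \o (fun w => f w ^+ 2)).
Proof.
move=> mf [K fK]; apply: bounded_integrable => //.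
  by apply: measurable_funX; exact: (adapted_measurable (@Gm n)).
exists (K ^+ 2) => w; rewrite normrX ler_pXn2r// ?nnegrE//.
exact: le_trans (fK w).
Qed.

(** Orthogonality of increments: the cross term has the weight [2 * transform c n * c n], bounded
    and known at time [n], so it integrates to zero. The square of the noise is at most one, whence
    an inequality. *)
Lemma second_moment_transform c : bounded_adapted c -> forall n,
  \int[Pr]_w (transform c n w ^+ 2) <=
  \sum_(0 <= k < n) \int[Pr]_w (c k w ^+ 2).
Proof.
move=> hc; elim=> [|n IH].
  rewrite big_geq//.
  under eq_Rintegral do rewrite /transform big_geq// expr0n/=.
  by rewrite Rintegral_cst// mul0r.
rewrite big_nat_recr//=.
have [mc [L cL]] := hc n.
have mS : adapted (G n) (transform c n) by exact: adapted_transform.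
have [K SK] := transform_bound hc n.
have mc' := adapted_measurable (@Gm n) mc.
have mS' := adapted_measurable (@Gm n) mS.
have mx' := adapted_measurable (@Gm n.+1) (@adapted_noise n).
have nz w : `|2 * transform c n w * c n w * noise n w| <= 2 * K * L.
  rewrite -[leRHS]mulr1 !normrM !ler_pM ?mulr_ge0 ?noise_bound//.
  by rewrite ger0_norm.
have I1 : Pr.-integrable setT (EFin \o (fun w => transform c n w ^+ 2)).
  by apply: (sqr_integrable mS); exists K.
have I2 : Pr.-integrable setT (EFin \o (fun w => c n w ^+ 2)).
  by apply: (sqr_integrable mc); exists L.
have I3 : Pr.-integrable setT
    (EFin \o (fun w => 2 * transform c n w * c n w * noise n w)).
  apply: bounded_integrable => //; last by exists (2 * K * L).
  by do 3 apply: measurable_funM => //.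
have cross : \int[Pr]_w (2 * transform c n w * c n w * noise n w) = 0.
  rewrite (Rintegral_proportional (@Gm n)
    (Z := fun w => 2 * transform c n w * c n w))//.
  - by apply: (@Gm n.+1).
  - by apply: (@Gm n.+1).
  - by have /andP[] := p01 n.
  - exact: AB.
  - by do 2 apply: measurable_funM => //.
  - exists (2 * K * L) => w; rewrite !normrM !ler_pM ?mulr_ge0//.
    by rewrite ger0_norm.
apply: (@le_trans _ _ (\int[Pr]_w ((transform c n w ^+ 2 + c n w ^+ 2) +
    2 * transform c n w * c n w * noise n w))).
  apply: le_Rintegral => //.
  - apply: (@sqr_integrable n.+1); first exact: adapted_transform.
    exact: transform_bound.
  - have := integrableD measurableT (integrableD measurableT I1 I2) I3.
    by apply: eq_integrable => // w _.
  - move=> w _; rewrite transformS.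
    have -> : (transform c n w + c n w * noise n w) ^+ 2 =
      transform c n w ^+ 2 + (c n w * noise n w) ^+ 2 +
      2 * transform c n w * c n w * noise n w by ring.
    rewrite !lerD2r lerD2l exprMn ler_piMr ?sqr_ge0//.
    by rewrite -real_normK ?num_real// expr_le1// noise_bound.
rewrite RintegralD//; last first.
  have := integrableD measurableT I1 I2.
  by apply: eq_integrable => // w _.
by rewrite RintegralD// cross addr0 lerD2r.
Qed.

(** * Stopped transforms and the maximal inequality *)

Fixpoint stopped (c : nat -> Omega -> R) (e : R) n w : R :=
  if n is m.+1 then
    stopped c e m w +
    (if `|stopped c e m w| < e then c m w else 0) * noise m w
  else 0.

Definition stopped_coef c e n w : R :=
  if `|stopped c e n w| < e then c n w else 0.

Lemma transform_stopped c e n w :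
  transform (stopped_coef c e) n w = stopped c e n w.
Proof.
elim: n => [|n IH]; first by rewrite /transform big_geq.
by rewrite transformS IH.
Qed.

Lemma adapted_if (c : nat -> Omega -> R) (b : nat -> Omega -> bool) :
  (forall n, adapted (G n) (c n)) ->
  (forall n, measurable_fun [set: g_sigma_algebraType (G n)]
     (b n : g_sigma_algebraType (G n) -> bool)) ->
  forall n, adapted (G n) (fun w => if b n w then c n w else 0).
Proof.
by move=> mc mb n; apply: measurable_fun_ifT => //; exact: mc.
Qed.

Lemma bounded_adapted_stopped c e :
  bounded_adapted c -> bounded_adapted (stopped_coef c e).
Proof.
move=> hc.
have md n : adapted (G n) (stopped c e n) -> adapted (G n) (stopped_coef c e n).
  move=> mD; apply: measurable_fun_ifT => //; last by have [] := hc n.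
  by apply: measurable_fun_ltr => //; exact: measurableT_comp.
have mD n : adapted (G n) (stopped c e n).
  elim: n => [|n IH]; first exact: measurable_cst.
  apply: measurable_funD; first exact: adaptedS.
  apply: measurable_funM; last exact: adapted_noise.
  by apply: adaptedS; exact: md.
move=> n; split; first exact: md.
have [_ [K cK]] := hc n; exists K => w.
rewrite /stopped_coef; case: ifPn => // _; rewrite normr0.
exact: le_trans (cK w).
Qed.

Lemma stopped_transform c e n w :
  (forall l, (l <= n)%N -> `|transform c l w| < e) ->
  stopped c e n w = transform c n w.
Proof.
elim: n => [|n IH] h; first by rewrite /transform big_geq.
rewrite /= IH; last by move=> l ln; apply: h; exact: leqW.
by rewrite h// transformS.
Qed.

(** Up to the first passage the stopped sum agrees with the transform, and afterwards it keeps the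
    value reached there. *)
Lemma stopped_exceeds c e n w :
  (exists2 l, (l <= n)%N & e <= `|transform c l w|) -> e <= `|stopped c e n w|.
Proof.
elim: n => [|n IH].
  by move=> [l]; rewrite leqn0 => /eqP ->; rewrite /transform big_geq.
move=> [l ln le].
have [h|h] := pselect (exists2 l, (l <= n)%N & e <= `|transform c l w|).
  by rewrite /= ltNge (IH h)/= mul0r addr0; exact: IH.
have h' k : (k <= n)%N -> `|transform c k w| < e.
  by move=> kn; rewrite ltNge; apply/negP => ek; apply: h; exists k.
rewrite /= stopped_transform// h'//.
rewrite -transformS; move: ln; rewrite leq_eqVlt => /orP[/eqP <-//|].
by rewrite ltnS => ln; move: (h' l ln); rewrite ltNge le.
Qed.

Definition exceeds (c : nat -> Omega -> R) (e : R) n : set Omega :=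
  [set w | exists2 l, (l <= n)%N & e <= `|transform c l w|].

Lemma measurable_exceeds c e n :
  bounded_adapted c -> measurable (exceeds c e n).
Proof.
move=> hc.
have -> : exceeds c e n =
    \bigcup_(l in `I_n.+1) [set w | e <= `|transform c l w|].
  by apply/seteqP; split => w [l]; exists l.
apply: fin_bigcup_measurable; first exact: finite_II.
move=> l _.
have mS : measurable_fun setT (fun w => e <= `|transform c l w|).
  apply: measurable_fun_ler => //; apply: measurableT_comp => //.
  by apply: (adapted_measurable (@Gm l)); exact: adapted_transform.
by have := mS measurableT [set true] I; rewrite setTI.
Qed.

(** Chebyshev's inequality for the stopped sum, whose square is at least [e ^+ 2] on the whole
    event. Stopping only replaces coefficients by zero, so the second moment is still bounded by the
    sum for [c]. *)
Lemma maximal_inequality c e n : bounded_adapted c -> 0 < e ->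
  (Pr (exceeds c e n) <=
    (e ^- 2 * \sum_(0 <= k < n) \int[Pr]_w (c k w ^+ 2))%:E)%E.
Proof.
move=> hc e0; have mE := @measurable_exceeds c e n hc.
have hd := bounded_adapted_stopped e hc.
have PE : fine (Pr (exceeds c e n)) = \int[Pr]_w (\1_(exceeds c e n) w).
  by rewrite /Rintegral integral_indic// setIT.
rewrite -[leLHS]fineK ?fin_num_measure// lee_fin PE.
rewrite ler_pdivlMl ?exprn_gt0//.
have I1 : Pr.-integrable setT (EFin \o (\1_(exceeds c e n) : Omega -> R)).
  exact: integrable_indic.
rewrite -RintegralZl//.
apply: (@le_trans _ _ (\int[Pr]_w (transform (stopped_coef c e) n w ^+ 2))).
  apply: le_Rintegral => //.
  - have := integrableZl measurableT (e ^+ 2) I1.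
    by apply: eq_integrable => // w _.
  - apply: (@sqr_integrable n); first exact: adapted_transform.
    exact: transform_bound.
  move=> w _; rewrite indicE; have [h|h] := boolP (w \in _); last first.
    by rewrite mulr0 sqr_ge0.
  rewrite mulr1 transform_stopped -[leRHS]real_normK ?num_real//.
  rewrite ler_pXn2r ?nnegrE ?(ltW e0)//; apply: stopped_exceeds.
  by move: h; rewrite inE.
apply: le_trans (second_moment_transform hd n) _.
apply: ler_sum => k _; apply: le_Rintegral => //.
- by apply: (@sqr_integrable k); have [] := hd k.
- by apply: (@sqr_integrable k); have [] := hc k.
- by move=> w _; rewrite /stopped_coef; case: ifPn; rewrite // expr0n sqr_ge0.
Qed.

(** * Almost sure convergence from bounded sums of squares *)

Definition tail (c : nat -> Omega -> R) m n w : R :=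
  if (m <= n)%N then c n w else 0.

Lemma bounded_adapted_tail c m :
  bounded_adapted c -> bounded_adapted (tail c m).
Proof.
move=> hc n; have [mc [K cK]] := hc n; rewrite /tail; case: (m <= n)%N.
  by split=> //; exists K.
by split; [exact: measurable_cst | exists 0 => w; rewrite normr0].
Qed.

Lemma transform_tail c m l w : (m <= l)%N ->
  transform (tail c m) l w = transform c l w - transform c m w.
Proof.
move=> ml; rewrite /transform !(big_cat_nat (leq0n m) ml)/= addrAC subrr add0r.
rewrite big_nat_cond big1 ?add0r => [|k]; last first.
  by rewrite andbT => /andP[_ km]; rewrite /tail leqNgt km mul0r.
by apply: eq_big_nat => k /andP[mk _]; rewrite /tail mk.
Qed.

Lemma sum_Rintegral_sqr c n : bounded_adapted c ->
  \sum_(0 <= k < n) \int[Pr]_w (c k w ^+ 2) =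
  \int[Pr]_w (\sum_(0 <= k < n) c k w ^+ 2).
Proof.
move=> hc.
have Ic k : Pr.-integrable setT (EFin \o (fun w => c k w ^+ 2)).
  by apply: (@sqr_integrable k); have [] := hc k.
have IS m : Pr.-integrable setT
    (EFin \o (fun w => \sum_(0 <= k < m) c k w ^+ 2)).
  apply: (eq_integrable _
    (fun w => (\sum_(0 <= k < m) (c k w ^+ 2)%:E)%E)) => //.
    by move=> w _ /=; rewrite sumEFin.
  by apply: integrable_sum => // k _; exact: Ic.
elim: n => [|n IH].
  rewrite big_geq//; under eq_Rintegral do rewrite big_geq//.
  by rewrite Rintegral_cst// mul0r.
rewrite big_nat_recr//= IH -RintegralD//.
by apply: eq_Rintegral => w _; rewrite big_nat_recr.
Qed.

(** The mean squares are summable, so by the maximal inequality a departure by [e] after time [m]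
    has probability vanishing with [m]. Almost every path is therefore Cauchy. *)
Lemma transform_cvg_bounded c (K : R) : bounded_adapted c ->
  (forall n w, \sum_(0 <= k < n) c k w ^+ 2 <= K) ->
  {ae Pr, forall w, cvgn (transform c ^~ w)}.
Proof.
move=> hc cK.
pose u n := \sum_(0 <= k < n) \int[Pr]_w (c k w ^+ 2).
have u_nd : nondecreasing_seq u.
  move=> m n mn; rewrite /u (big_cat_nat (leq0n m) mn)/= lerDl.
  by apply: sumr_ge0 => k _; apply: Rintegral_ge0 => w _; exact: sqr_ge0.
have uK n : u n <= K.
  rewrite /u sum_Rintegral_sqr//.
  apply: (@le_trans _ _ (\int[Pr]_w K)); last first.
    rewrite Rintegral_cst// [X in fine X](_ : _ = 1%E) ?mulr1//.
    exact: probability_setT.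
  apply: le_Rintegral => //.
    apply: (eq_integrable _
      (fun w => (\sum_(0 <= k < n) (c k w ^+ 2)%:E)%E)) => //.
      by move=> w _ /=; rewrite sumEFin.
    apply: integrable_sum => // k _.
    by apply: (@sqr_integrable k); have [] := hc k.
  by apply: bounded_integrable => //; exists `|K|.
have u_cvg : cvgn u.
  by apply: nondecreasing_is_cvgn => //; exists K => _ [n _ <-].
have u_tail (e : R) : 0 < e -> exists m, forall n,
    \sum_(0 <= k < n) \int[Pr]_w (tail c m k w ^+ 2) <= e.
  move=> e0; have /cvgrPdist_le /(_ e e0) [m _ hm] := u_cvg.
  have um := hm m (leqnn m); exists m => n.
  have ul n' := nondecreasing_cvgn_le u_nd u_cvg n'.
  have [nm|mn] := leqP n m.
    rewrite big_nat_cond big1 ?(ltW e0)// => k; rewrite andbT => /andP[_ kn].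
    have km : (k < m)%N by apply: leq_trans nm.
    under eq_Rintegral do rewrite /tail leqNgt km/= expr0n.
    by rewrite Rintegral_cst// mul0r.
  rewrite (big_cat_nat (leq0n m) (ltnW mn))/=.
  rewrite big_nat_cond big1 ?add0r => [|k]; last first.
    rewrite andbT => /andP[_ km].
    under eq_Rintegral do rewrite /tail leqNgt km/= expr0n.
    by rewrite Rintegral_cst// mul0r.
  have -> : \sum_(m <= k < n) \int[Pr]_w (tail c m k w ^+ 2) = u n - u m.
    rewrite /u (big_cat_nat (leq0n m) (ltnW mn))/=.
    rewrite addrAC subrr add0r; apply: eq_big_nat => k /andP[mk _].
    by apply: eq_Rintegral => w _; rewrite /tail mk.
  move: um; rewrite /= ger0_norm ?subr_ge0//; apply: le_trans.
  by rewrite lerD2r.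
(* The paths that, for every [m], later move at least [e] away from their value at time [m]. *)
pose N (e : R) := \bigcap_m \bigcup_n exceeds (tail c m) e n.
have mU e m : measurable (\bigcup_n exceeds (tail c m) e n).
  apply: bigcupT_measurable => n; apply: measurable_exceeds.
  exact: bounded_adapted_tail.
have N0 (e : R) : 0 < e -> Pr (N e) = 0%E.
  move=> e0; apply/eqP; rewrite eq_le measure_ge0 andbT.
  apply/lee_addgt0Pr => f f0; rewrite add0e.
  (* The factor [e ^+ 2] cancels the [e ^- 2] of the maximal inequality and leaves [f]. *)
  have [m hm] := u_tail (e ^+ 2 * f) (mulr_gt0 (exprn_gt0 2 e0) f0).
  apply: (@le_trans _ _ (Pr (\bigcup_n exceeds (tail c m) e n))).
    apply: le_measure; rewrite ?inE//; first exact: bigcapT_measurable.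
    exact: bigcap_inf.
  have h : (Pr \o exceeds (tail c m) e) n @[n --> \oo] -->
      Pr (\bigcup_n exceeds (tail c m) e n).
    apply: nondecreasing_cvg_mu => //.
      by move=> n; apply: measurable_exceeds; exact: bounded_adapted_tail.
    move=> n n' nn'; apply/subsetPset => w [l ln le]; exists l => //.
    exact: leq_trans nn'.
  apply: (cvge_to_le h); apply: nearW => n /=.
  apply: le_trans (maximal_inequality _ (bounded_adapted_tail m hc) e0) _.
  by rewrite lee_fin ler_pdivrMl ?exprn_gt0.
(* Countably many levels suffice, and keep the exceptional set null. *)
have : {ae Pr, forall w, forall j : nat, ~ N (j.+1%:R^-1) w}.
  apply: ae_foralln => j; exists (N j.+1%:R^-1); split.
  - by apply: bigcapT_measurable => m; exact: mU.
  - by apply: N0; rewrite invr_gt0.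
  - by move=> w /= /contrapT.
apply: filterS => w hw; apply/cauchy_cvgP; apply: cauchy_exP => e e0.
have [j je] : exists j : nat, j.+1%:R^-1 < e.
  exists (Num.truncn e^-1); rewrite invf_plt ?posrE//.
  by rewrite truncnS_gt.
have /existsNP[m hm] :
    ~ forall m, (\bigcup_n exceeds (tail c m) j.+1%:R^-1 n) w.
  by move=> h; apply: (hw j) => m _; exact: h.
exists (transform c m w); exists m => // l /= ml.
rewrite /ball/= distrC -transform_tail//; apply: lt_trans je.
by rewrite ltNge; apply/negP => h; apply: hm; exists l => //; exists l.
Qed.

(** Here the bound on the squares may depend on the path. For each integer [K] the coefficients are
    cut off once their squares sum to more than [K]; a path with bound below [K] does not feel the
    cut, and there are countably many [K]. *)
Lemma transform_cvg c : (forall n, adapted (G n) (c n)) ->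
  {ae Pr, forall w,
    (exists K : R, forall n, \sum_(0 <= k < n) c k w ^+ 2 <= K) ->
    cvgn (transform c ^~ w)}.
Proof.
move=> mc.
pose s n w := \sum_(0 <= k < n) c k w ^+ 2.
have s_nd w : nondecreasing_seq (s ^~ w).
  move=> m n mn; rewrite /s (big_cat_nat (leq0n m) mn)/= lerDl.
  by apply: sumr_ge0 => k _; exact: sqr_ge0.
(* The test includes the current square, so the truncated sum never overshoots [K]; it is still
   adapted because [c n] is known at time [n]. *)
pose t (K : nat) n w := if s n.+1 w <= K%:R then c n w else 0.
have tK K n w : \sum_(0 <= k < n) t K k w ^+ 2 <= K%:R.
  elim: n => [|n IH]; first by rewrite big_geq.
  have [h|h] := boolP (s n.+1 w <= K%:R); last first.
    by rewrite big_nat_recr//= /t (negbTE h) expr0n addr0.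
  rewrite -[X in X <= _](_ : s n.+1 w = _)//.
  apply: eq_big_nat => k /andP[_ kn]; rewrite /t ifT//.
  by apply: le_trans h; exact: s_nd.
have ms n : adapted (G n) (s n.+1).
  elim: n => [|n IH].
    have -> : s 1 = (fun w => c 0 w ^+ 2).
      by apply/funext => w; rewrite /s big_nat1.
    by apply: measurable_funX; exact: mc.
  have -> : s n.+2 = (fun w => s n.+1 w + c n.+1 w ^+ 2).
    by apply/funext => w; rewrite /s big_nat_recr.
  apply: measurable_funD; first exact: adaptedS.
  by apply: measurable_funX; exact: mc.
have ht K : bounded_adapted (t K).
  move=> n; split.
    apply: (@adapted_if c (fun k w => s k.+1 w <= K%:R)) => // k.
    apply: measurable_fun_ler; first exact: ms.
    exact: measurable_cst.
  (* Either [|t| <= 1], or [|t| <= t ^+ 2 <= K]. *)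
  exists (K%:R + 1) => w; have := tK K n.+1 w; rewrite big_nat_recr//=.
  have : 0 <= \sum_(0 <= k < n) t K k w ^+ 2.
    by apply: sumr_ge0 => k _; exact: sqr_ge0.
  rewrite -[in t K n w ^+ 2]real_normK ?num_real//.
  have : 0 <= K%:R :> R by [].
  move: (\sum_(_ <= _ < _) _) (K%:R) => x y y0 x0 h.
  have [n1|n1] := leP `|t K n w| 1; first by lra.
  have : `|t K n w| <= `|t K n w| ^+ 2 by rewrite expr2 ler_peMl// ltW.
  lra.
have : {ae Pr, forall w, forall K : nat, cvgn (transform (t K) ^~ w)}.
  by apply: ae_foralln => K; apply: (transform_cvg_bounded (ht K) (tK K)).
apply: filterS => w hw [K hK].
have [k Kk] : exists k : nat, K <= k%:R.
  by exists (Num.truncn K).+1; rewrite ltW// truncnS_gt.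
have -> : transform c ^~ w = transform (t k) ^~ w; last exact: hw.
apply/funext => n; apply: eq_big_nat => l _; rewrite /t ifT//.
exact: le_trans (hK _) Kk.
Qed.

End Process.
End Martingale.

(** * The tabular recursion and its filtration *)

(** An iterated binary maximum lets measurability be proved by induction on the enumeration. The
    default [f t0] is itself one of the values. *)
Lemma maxf_bigmax (R : realType) (T : finType) (t0 : T) (f : T -> R) :
  maxf f = \big[Num.max/f t0]_t f t.
Proof.
have [u [-> fu]] := maxf_attained f t0; apply/eqP; rewrite eq_le.
by rewrite le_bigmax_cond//=; apply/bigmax_leP; split.
Qed.

Lemma measurable_maxf (R : realType) (d : measure_display)
    (X : measurableType d) (T : finType) (t0 : T) (f : T -> X -> R) :
  (forall t, measurable_fun setT (f t)) ->
  measurable_fun setT (fun x => maxf (fun t => f t x)).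
Proof.
move=> mf.
have -> : (fun x => maxf (fun t => f t x)) =
    (fun x => \big[Num.max/f t0 x]_t f t x).
  by apply/funext => x; exact: maxf_bigmax.
elim: (index_enum T) => [|t s IH].
  by under eq_fun do rewrite big_nil; exact: mf.
under eq_fun do rewrite big_cons; exact: measurable_maxr.
Qed.

Lemma maxfB (R : realType) (T : finType) (t0 : T) (f : T -> R) (c : R) :
  maxf (fun t => f t - c) = maxf f - c.
Proof.
have [u [-> fu]] := maxf_attained f t0.
have [v [-> fv]] := maxf_attained (fun t => f t - c) t0.
by apply/eqP; rewrite eq_le fv lerD2r fu.
Qed.

Lemma maxf_norm_le (R : realType) (T : finType) (t0 : T) (f : T -> R) (C : R) :
  (forall t, `|f t| <= C) -> `|maxf f| <= C.
Proof. by move=> fC; have [u [-> _]] := maxf_attained f t0. Qed.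

Section Tabular.
Context (R : realType) (S A : finType).
Implicit Types (x : S * A) (theta : 'cV[R]_#|{: S * A}|).

Lemma dotv_tabular x theta : dotv (tabular x) theta = theta (enum_rank x) 0.
Proof.
rewrite /dotv mxE (bigD1 (enum_rank x))//= !mxE !eqxx mul1r big1 ?addr0//.
by move=> j jx; rewrite !mxE (negbTE jx) mul0r.
Qed.

(** The lowest point of a ball along a coordinate axis lies one radius below the center.
    Regularization thus shifts all coordinates equally and will leave the maximum as a constant. *)
Lemma worst_value_tabularE x (rho : R) theta : 0 <= rho ->
  worst_value (tabular x) rho theta = theta (enum_rank x) 0 - Num.sqrt rho.
Proof.
move=> rho0; have [th [thP [-> thmin]]] := worst_value_tabular x theta rho0.
apply/eqP; rewrite eq_le; apply/andP; split.
  have := thmin (theta - Num.sqrt rho *: tabular x).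
  rewrite !dotv_tabular !mxE !eqxx mulr1; apply.
  rewrite /norm2sq subKr (bigD1 (enum_rank x))//= big1 ?addr0.
    by rewrite !mxE !eqxx mulr1 sqr_sqrtr.
  by move=> j jx; rewrite !mxE (negbTE jx) mulr0 expr0n.
rewrite dotv_tabular lerBlDr -lerBlDl.
apply: le_trans (ler_norm _) _; rewrite -sqrtr_sqr ler_sqrt//.
apply: le_trans thP; rewrite /norm2sq (bigD1 (enum_rank x))//= !mxE lerDl.
by apply: sumr_ge0 => j _; exact: sqr_ge0.
Qed.

Lemma feature_mx_tabular theta : (feature_mx tabular)^T *m theta = theta.
Proof.
suff -> : feature_mx tabular = 1%:M :> 'M[R]_#|{: S * A}|.
  by rewrite trmx1 mul1mx.
apply/matrixP => i j; rewrite !mxE enum_valK.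
by rewrite eqxx andbT.
Qed.

Variables (r : S * A -> R) (gamma : R) (rho : nat -> R) (Omega : Type).
Variables (Sn : nat -> Omega -> S) (An : nat -> Omega -> A).
Variables (alpha : nat -> S * A -> Omega -> R) (N : nat).
Variables (beta : nat -> Omega -> 'rV[R]_N).
Variables (theta0 : 'I_N -> Omega -> 'cV[R]_#|{: S * A}|).

Definition estimate n i x w : R :=
  twoRA tabular r gamma rho Sn An alpha beta theta0 n i w (enum_rank x) 0.

Definition estimate_hat n x w : R := N%:R^-1 * \sum_i estimate n i x w.

Definition greedy_value n s w : R := maxf (fun a => estimate_hat n (s, a) w).

Lemma theta_hatE n x w :
  theta_hat tabular r gamma rho Sn An alpha beta theta0 n w (enum_rank x) 0 =
  estimate_hat n x w.
Proof. by rewrite /theta_hat /average !mxE summxE. Qed.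

(** For unit features, [A1mx] projects onto the coordinate of the visited pair, so no other
    coordinate moves. *)
Lemma estimateS (a0 : A) n i x w : 0 <= rho n ->
  estimate n.+1 i x w = estimate n i x w +
    (x == (Sn n w, An n w))%:R * (alpha n x w * beta n w 0 i) *
    (r x + gamma * (greedy_value n (Sn n.+1 w) w - Num.sqrt (rho n))
     - estimate n i x w).
Proof.
move=> rho0; rewrite /estimate /=; set X := (Sn n w, An n w).
set th := twoRA _ _ _ _ _ _ _ _ _ n i w.
have A1E : A1mx tabular X *m th = th (enum_rank X) 0 *: tabular X.
  apply/matrixP => k l; rewrite ord1 /A1mx -mulmxA !mxE big_ord1.
  by rewrite -[_ 0 0]/(dotv (tabular X) th) dotv_tabular mxE mulrC.
rewrite mxE; congr (_ + _); rewrite A1E /bvec /reg_term /greedy_value.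
rewrite -(maxfB a0).
have -> : (fun a => worst_value (tabular (Sn n.+1 w, a)) (rho n)
    (average (fun j => twoRA tabular r gamma rho Sn An alpha beta theta0 n j w)))
    = (fun a => estimate_hat n (Sn n.+1 w, a) w - Num.sqrt (rho n)).
  by apply/funext => a; rewrite worst_value_tabularE// -theta_hatE.
rewrite !mxE (inj_eq enum_rank_inj) eqxx andbT.
have [->|_] := eqVneq x X;
  rewrite ?mulr1 ?mul1r ?mulr0 ?mul0r ?subrr ?addr0 ?mulr0//.
by rewrite addrAC.
Qed.

End Tabular.

Section Filtration.
Context (R : realType) (S A : finType) (d : measure_display)
  (Omega : measurableType d) (Pr : probability Omega R).
Context (r : S * A -> R) (gamma : R) (rho : nat -> R).
Context (Sn : nat -> Omega -> S) (An : nat -> Omega -> A).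
Context (alpha : nat -> S * A -> Omega -> R) (N : nat).
Context (beta : nat -> Omega -> 'rV[R]_N).
Context (theta0 : 'I_N -> Omega -> 'cV[R]_#|{: S * A}|).
Hypothesis Sn_rv : forall n, measurable_events (events_fin (Sn n)).
Hypothesis An_rv : forall n, measurable_events (events_fin (An n)).
Hypothesis alpha_rv : forall n x, measurable_events (events_real (alpha n x)).
Hypothesis beta_rv : forall n, measurable_events (events_mx (beta n)).
Hypothesis theta0_rv : forall i, measurable_events (events_mx (theta0 i)).
Hypothesis rho_ge0 : forall n, 0 <= rho n.

Local Notation GF := (Gfield Sn An alpha beta theta0).
Local Notation q := (estimate r gamma rho Sn An alpha beta theta0).
Local Notation qhat := (estimate_hat r gamma rho Sn An alpha beta theta0).
Local Notation V := (greedy_value r gamma rho Sn An alpha beta theta0).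

Lemma Gfield_sigma_algebra n : sigma_algebra setT (GF n).
Proof. exact: smallest_sigma_algebra. Qed.

Lemma GfieldE n : <<s GF n>> = GF n.
Proof. exact/sigma_algebra_id/Gfield_sigma_algebra. Qed.

Lemma Gfield_measurable n : <<s GF n>> `<=` measurable.
Proof.
rewrite GfieldE; apply: smallest_sub; first exact: sigma_algebra_measurable.
move=> E [[[i _]|[k _ [[|]|[x _]]]]|[k _]].
- exact: theta0_rv.
- exact: Sn_rv.
- exact: An_rv.
- exact: alpha_rv.
- exact: beta_rv.
Qed.

Lemma GfieldS n : <<s GF n>> `<=` <<s GF n.+1>>.
Proof.
rewrite !GfieldE; apply: sub_sigma_algebra2.
move=> E [[h|[k /= kn h]]|[k /= kn h]]; [by left; left|left; right|right].
- by exists k => //=; exact: ltnW.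
- by exists k => //=; exact: ltnW.
Qed.

Lemma GfieldI n E F : GF n E -> GF n F -> GF n (E `&` F).
Proof.
by rewrite -GfieldE; exact: (@measurableI _ (g_sigma_algebraType (GF n))).
Qed.

Lemma Gfield_Sn n s : GF n (Sn n @^-1` [set s]).
Proof.
apply: sub_sigma_algebra; left; right; exists n => //=; left; left.
by exists [set s] => //; rewrite setTI.
Qed.

Lemma Gfield_An n a : GF n (An n @^-1` [set a]).
Proof.
apply: sub_sigma_algebra; left; right; exists n => //=; left; right.
by exists [set a] => //; rewrite setTI.
Qed.

Definition visit n (x : S * A) : set Omega := [set w | x = (Sn n w, An n w)].

Lemma in_visit n x w : (w \in visit n x) = (x == (Sn n w, An n w)).
Proof. by apply/idP/eqP; rewrite inE. Qed.

Lemma Gfield_visit n x : GF n (visit n x).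
Proof.
have -> : visit n x = Sn n @^-1` [set x.1] `&` An n @^-1` [set x.2].
  by case: x => s a; rewrite /visit; apply/seteqP; split => w /= [-> ->].
by apply: GfieldI; [exact: Gfield_Sn|exact: Gfield_An].
Qed.

Lemma adapted_alpha n x : adapted (GF n) (alpha n x).
Proof.
move=> _ Y mY; apply: sub_sigma_algebra; apply: sub_sigma_algebra.
by left; right; exists n => //=; right; exists x => //; exists Y.
Qed.

Lemma adapted_beta n i : adapted (GF n.+1) (fun w => beta n w 0 i).
Proof.
move=> _ Y mY; apply: sub_sigma_algebra; apply: sub_sigma_algebra.
right; exists n => //=; apply: sub_sigma_algebra.
by exists (0, i) => //; exists Y.
Qed.

Lemma adapted_theta0 i k : adapted (GF 0) (fun w => theta0 i w k 0).
Proof.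
move=> _ Y mY; apply: sub_sigma_algebra; apply: sub_sigma_algebra.
left; left; exists i => //; apply: sub_sigma_algebra.
by exists (k, 0) => //; exists Y.
Qed.

Lemma adapted_greedy_value (a0 : A) n s :
  (forall i x, adapted (GF n) (q n i x)) -> adapted (GF n) (V n s).
Proof.
move=> hq; apply: (@measurable_maxf R _ (g_sigma_algebraType (GF n)) A a0
  (fun a w => qhat n (s, a) w)) => a.
apply: measurable_funM => //; apply: measurable_sum => i; exact: hq.
Qed.

Lemma adapted_estimate (a0 : A) n i x : adapted (GF n) (q n i x).
Proof.
elim: n i x => [|n IH] i x; first exact: adapted_theta0.
(* The value at the random next state is expanded over all states: each [V n s] is known at time
   [n], and the indicators at time [n.+1]. *)
have -> : q n.+1 i x = fun w => q n i x w + \1_(visit n x) w *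
    (alpha n x w * beta n w 0 i) * (r x + gamma *
      (\sum_s \1_(Sn n.+1 @^-1` [set s]) w * V n s w - Num.sqrt (rho n))
      - q n i x w).
  apply/funext => w; rewrite (estimateS r gamma Sn An alpha beta theta0 a0)//.
  rewrite indicE; congr (_ + (_)%:R * _ * (_ + _ * (_ - _) - _)).
    by rewrite in_visit.
  rewrite (bigD1 (Sn n.+1 w))//= indicE mem_set// mul1r big1 ?addr0// => s sS.
  by rewrite indicE memNset ?mul0r// => /= h; rewrite h eqxx in sS.
have adS f : adapted (GF n) f -> adapted (GF n.+1) f.
  by apply: adaptedS; exact: GfieldS.
have mq : adapted (GF n.+1) (q n i x) by exact: adS.
apply: measurable_funD => //; apply: measurable_funM.
  apply: measurable_funM.
    apply: measurable_indic; rewrite /measurable/=.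
    by apply: GfieldS; rewrite GfieldE; exact: Gfield_visit.
  apply: measurable_funM; last exact: adapted_beta.
  by apply: adS; exact: adapted_alpha.
apply: measurable_funB => //; apply: measurable_funD => //.
apply: measurable_funM => //; apply: measurable_funB => //.
apply: measurable_sum => s; apply: measurable_funM.
  by apply: measurable_indic; rewrite /measurable/= GfieldE; exact: Gfield_Sn.
by apply: adS; exact: adapted_greedy_value.
Qed.

(** * The draws and the two noise series *)

Definition draws n (i : 'I_N) : set Omega := beta n @^-1` [set delta_mx 0 i].

Lemma draws_events n i : events_mx (beta n) (draws n i).
Proof.
have -> : draws n i =
    \bigcap_(j in [set: 'I_N]) 
      [set w | beta n w 0 j = (delta_mx 0 i : 'rV[R]_N) 0 j].
  rewrite /draws; apply/seteqP; split => w /=.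
    by move=> bw j _ /=; rewrite bw.
  by move=> h; apply/rowP => j; exact: h.
have sg : @sigma_algebra Omega setT (events_mx (beta n)).
  exact: smallest_sigma_algebra.
rewrite -(sigma_algebra_id sg).
apply: (@fin_bigcap_measurable _
  (g_sigma_algebraType (events_mx (beta n)))) => //.
move=> j _; apply: sub_sigma_algebra; apply: sub_sigma_algebra.
exists (0, j) => //; exists [set (delta_mx 0 i : 'rV[R]_N) 0 j] => //.
by rewrite setTI.
Qed.

Lemma Gfield_draws n i : GF n.+1 (draws n i).
Proof.
have := @draws_events n i; apply: smallest_sub.
  exact: Gfield_sigma_algebra.
move=> E hE; apply: sub_sigma_algebra; right; exists n => //=.
exact: sub_sigma_algebra.
Qed.

Context (P : S * A -> S -> R).
Hypothesis P_kernel : is_kernel P.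
Hypothesis N_gt0 : (0 < N)%N.
Hypothesis Sn_law : forall n,
  cond_law Pr (GF n) (Sn n.+1) (fun w => P (Sn n w, An n w)).
Hypothesis beta_law : forall n (i : 'I_N), Pr (draws n i) = (N%:R^-1)%:E.
Hypothesis beta_indep_past : forall n,
  independent_fields Pr (events_mx (beta n))
  (Gfield_next Sn An alpha beta theta0 n).

Lemma measurable_GF n E : GF n E -> measurable E.
Proof. by move=> h; apply: (@Gfield_measurable n); rewrite GfieldE. Qed.

Lemma kernel_le1 x t : 0 <= P x t <= 1.
Proof.
have [P0 P1] := P_kernel; rewrite P0/= -(P1 x) (bigD1 t)//= lerDl.
by apply: sumr_ge0 => s _; exact: P0.
Qed.

Lemma draws_indep n i E : Gfield_next Sn An alpha beta theta0 n E ->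
  Pr (E `&` draws n i) = ((N%:R^-1)%:E * Pr E)%E.
Proof.
move=> hE; rewrite setIC -(beta_law n i).
exact: (beta_indep_past (@draws_events n i) hE).
Qed.

(** Compares the steps received by estimate [i] with their share [N^-1] of all steps; this carries
    divergence of [sum alpha] over to each estimate. *)
Lemma draws_noise_cvg i x :
  {ae Pr, forall w, (exists K : R, forall n,
      \sum_(0 <= k < n) alpha k x w ^+ 2 <= K) ->
    cvgn (fun n => \sum_(0 <= k < n) alpha k x w *
      (\1_(draws k i) w - N%:R^-1 * \1_[set: Omega] w))}.
Proof.
apply: (@transform_cvg R d Omega Pr GF (fun k => draws k i) (fun=> setT)
  (fun=> N%:R^-1)).
- exact: Gfield_measurable.
- exact: GfieldS.
- by move=> n; rewrite GfieldE; exact: Gfield_draws.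
- by move=> n; exact: (@measurableT _ (g_sigma_algebraType (GF n.+1))).
- by move=> n; rewrite invr_ge0 ler0n/= invf_le1 ?ltr0n// ler1n.
- move=> n E; rewrite GfieldE => hE; rewrite setIT; apply: draws_indep.
  by apply: sub_sigma_algebra; left.
- by move=> n; exact: adapted_alpha.
Qed.

(** The next state is treated one value [t] at a time. The draw is not known at time [n], so it
    enters through the events rather than the coefficient. *)
Lemma jump_noise_cvg (a0 : A) i x t :
  {ae Pr, forall w, (exists K : R, forall n,
      \sum_(0 <= k < n) (alpha k x w * V k t w) ^+ 2 <= K) ->
    cvgn (fun n => \sum_(0 <= k < n) alpha k x w * V k t w *
      (\1_(visit k x `&` draws k i `&` Sn k.+1 @^-1` [set t]) w -
       P x t * \1_(visit k x `&` draws k i) w))}.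
Proof.
have vd n : GF n.+1 (visit n x `&` draws n i).
  apply: GfieldI; last exact: Gfield_draws.
  by rewrite -GfieldE; apply: GfieldS; rewrite GfieldE; exact: Gfield_visit.
apply: (@transform_cvg R d Omega Pr GF
  (fun k => visit k x `&` draws k i `&` Sn k.+1 @^-1` [set t])
  (fun k => visit k x `&` draws k i) (fun=> P x t)
  _ _ _ _ _ _ (fun k w => alpha k x w * V k t w)).
- exact: Gfield_measurable.
- exact: GfieldS.
- by move=> n; rewrite GfieldE; apply: GfieldI => //; exact: Gfield_Sn.
- by move=> n; rewrite GfieldE.
- by move=> n; exact: kernel_le1.
- move=> n E; rewrite GfieldE => hE.
  have hE' : GF n (E `&` visit n x).
    by apply: GfieldI => //; exact: Gfield_visit.
  have hEn : Gfield_next Sn An alpha beta theta0 n (E `&` visit n x).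
    by apply: sub_sigma_algebra; left.
  have sgn : sigma_algebra setT (Gfield_next Sn An alpha beta theta0 n).
    exact: smallest_sigma_algebra.
  have hES : Gfield_next Sn An alpha beta theta0 n
      (E `&` visit n x `&` Sn n.+1 @^-1` [set t]).
    rewrite -(sigma_algebra_id sgn).
    apply: (@measurableI _ (g_sigma_algebraType _)).
      exact: sub_sigma_algebra.
    apply: sub_sigma_algebra; apply: sub_sigma_algebra; right.
    by exists [set t] => //; rewrite setTI.
  (* Independence of the draw from the past and the next state gives [N^-1] on both sides. What
     remains is the transition law on a set where the kernel is the constant [P x t]. *)
  rewrite !setIA [in LHS]setIAC !draws_indep//= muleCA; congr (_ * _)%E.
  rewrite Sn_law//.
  transitivity (\int[Pr]_(w in E `&` visit n x) (P x t)%:E)%E.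
    by apply: eq_integral => w; rewrite inE => -[_ <-].
  by rewrite integral_cst//; exact: measurable_GF hE'.
- move=> n; apply: measurable_funM; first exact: adapted_alpha.
  by apply: adapted_greedy_value => // j y; exact: adapted_estimate.
Qed.

(** The [N] events are disjoint of mass [N^-1] each, so they exhaust the probability. *)
Lemma ae_draws : {ae Pr, forall w, forall n, exists i, draws n i w}.
Proof.
apply: ae_foralln => n.
have md i : measurable (draws n i) by exact: measurable_GF (@Gfield_draws n i).
pose U := \big[setU/set0]_(i < N) draws n i.
have mU : measurable U by exact: bigsetU_measurable.
have PU : Pr U = 1%E.
  rewrite /U measure_semi_additive_ord//.
    transitivity (\sum_(i < N) (N%:R^-1)%:E : \bar R)%E.
      by apply: eq_bigr => i _; exact: beta_law.
    rewrite sumEFin sumr_const card_ord -(mulr_natr N%:R^-1) mulVf// pnatr_eq0.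
    by rewrite -lt0n.
  move=> i j _ _ [w []]; rewrite /draws /= => -> /matrixP /(_ 0 i) /eqP.
  rewrite !mxE !eqxx /=; have [//|_] := eqVneq i j.
  by rewrite oner_eq0.
exists (~` U); split.
- exact: measurableC.
- transitivity (1 - Pr U)%E; first exact: probability_setC.
  by rewrite PU subee.
- move=> w /= h Uw; apply: h.
  by move: Uw; rewrite /U -bigcup_seq => -[i _]; exists i.
Qed.

End Filtration.

(** * Convergence along a fixed sample path *)

Section Pathwise.
Context (R : realType) (S A : finType) (d : measure_display)
  (Omega : measurableType d).
Context (r : S * A -> R) (gamma : R) (rho : nat -> R).
Context (Sn : nat -> Omega -> S) (An : nat -> Omega -> A).
Context (alpha : nat -> S * A -> Omega -> R) (N : nat).
Context (beta : nat -> Omega -> 'rV[R]_N).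
Context (theta0 : 'I_N -> Omega -> 'cV[R]_#|{: S * A}|).
Hypothesis rho_ge0 : forall n, 0 <= rho n.
Hypothesis rho_cvg0 : rho @ \oo --> 0.
Hypothesis gamma01 : 0 < gamma < 1.
Hypothesis N_gt0 : (0 < N)%N.
Variables (a0 : A) (w : Omega).
Hypothesis alpha_visit : forall n x,
  x = (Sn n w, An n w) -> 0 < alpha n x w <= 1.
Hypothesis alpha_off : forall n x, x <> (Sn n w, An n w) -> alpha n x w = 0.
Hypothesis drawn : forall n, exists i, draws beta n i w.

Local Notation q := (estimate r gamma rho Sn An alpha beta theta0).
Local Notation qhat := (estimate_hat r gamma rho Sn An alpha beta theta0).
Local Notation V := (greedy_value r gamma rho Sn An alpha beta theta0).

(** The indicator is the form in which the draw appears in the noise series; [beta_indic] identifies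
    it with the entry of [beta]. *)
Definition step (j : 'I_N * (S * A)) n : R :=
  alpha n j.2 w * \1_(draws beta n j.1) w.

Lemma beta_indic n i : beta n w 0 i = \1_(draws beta n i) w.
Proof.
have [j hj] := drawn n; rewrite indicE hj mxE eqxx/=.
have [->|ij] := eqVneq i j; first by rewrite mem_set.
rewrite memNset// /draws/= hj => /matrixP /(_ 0 i) /eqP.
by rewrite !mxE !eqxx (negbTE ij)/= eq_sym oner_eq0.
Qed.

Lemma alpha01 n x : 0 <= alpha n x w <= 1.
Proof.
have [/alpha_visit/andP[/ltW -> ->]//|/alpha_off ->] :=
  pselect (x = (Sn n w, An n w)).
by rewrite lexx ler01.
Qed.

Lemma step01 j n : 0 <= step j n <= 1.
Proof.
have /andP[a_ge0 a_le1] := alpha01 n j.2; rewrite /step indicE.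
by case: (_ \in _); rewrite /= ?mulr1 ?mulr0 ?a_ge0 ?a_le1 ?lexx ?ler01.
Qed.

Lemma estimate_relax n i x : q n.+1 i x w = (1 - step (i, x) n) * q n i x w +
  step (i, x) n * (r x + gamma * (V n (Sn n.+1 w) w - Num.sqrt (rho n))).
Proof.
rewrite (estimateS r gamma Sn An alpha beta theta0 a0)// beta_indic mulrA.
have -> : (x == (Sn n w, An n w))%:R * alpha n x w = alpha n x w.
  by case: eqP => [_|/alpha_off ->]; rewrite ?mul1r ?mulr0.
by rewrite -/(step (i, x) n); ring.
Qed.

Lemma mean_norm_le (f : 'I_N -> R) (C : R) :
  (forall i, `|f i| <= C) -> `|N%:R^-1 * \sum_i f i| <= C.
Proof.
move=> fC; rewrite normrM ger0_norm ?invr_ge0// ler_pdivrMl ?ltr0n//.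
apply: le_trans (ler_norm_sum _ _ _) _.
apply: le_trans (_ : \sum_(i < N) C <= _); first exact: ler_sum.
by rewrite sumr_const card_ord -(mulr_natl C).
Qed.

Lemma sqrt_rho_cvg0 : (fun n => Num.sqrt (rho n)) @ \oo --> 0.
Proof.
rewrite -[X in _ --> X]sqrtr0.
by apply: (continuous_cvg _ _ rho_cvg0); exact: sqrt_continuous.
Qed.

Lemma sqrt_rho_bounded : exists c, forall n, Num.sqrt (rho n) <= c.
Proof.
have h : cvgn (fun n => Num.sqrt (rho n)).
  by apply/cvg_ex; exists 0; exact: sqrt_rho_cvg0.
have [M [_ hM]] := cvg_seq_bounded h.
exists (M + 1) => n; apply: le_trans (ler_norm _) _.
by apply: hM => //; rewrite ltrDl.
Qed.

Lemma estimate_bounded : exists B, forall n i x, `|q n i x w| <= B.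
Proof.
have /andP[g0 g1] := gamma01.
have [c hc] := sqrt_rho_bounded.
have c0 : 0 <= c by apply: le_trans (hc 0%N); exact: sqrtr_ge0.
pose M := \sum_x `|r x|.
have rM x : `|r x| <= M by rewrite /M (bigD1 x)//= lerDl sumr_ge0.
have M0 : 0 <= M by apply: sumr_ge0.
pose B0 := \sum_i \sum_x `|q 0 i x w|.
have B00 : 0 <= B0 by apply: sumr_ge0 => i _; apply: sumr_ge0.
(* The second term solves [u = M + c + gamma * u], which makes the bound [B] self-reproducing; [B0]
   covers the initial estimates. *)
pose B := B0 + (M + c) / (1 - gamma).
have Mc0 : 0 <= (M + c) / (1 - gamma).
  by rewrite divr_ge0 ?subr_ge0 ?(ltW g1)// addr_ge0.
have hB : M + gamma * (B + c) <= B.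
  have e : (M + c) / (1 - gamma) * (1 - gamma) = M + c.
    by rewrite divfK// subr_eq0 gt_eqF.
  move: Mc0 e; rewrite /B; move: ((M + c) / _) => u u0 e; nra.
exists B; elim=> [|n IH] i x.
  rewrite /B; apply: (@le_trans _ _ B0); last by rewrite lerDl.
  rewrite /B0 (bigD1 i)//= (bigD1 x)//= -addrA lerDl addr_ge0 ?sumr_ge0//.
  by move=> j _; apply: sumr_ge0.
have VB s : `|V n s w| <= B.
  by apply: (maxf_norm_le a0) => a; exact: mean_norm_le.
have /andP[s0 s1] := step01 (i, x) n.
rewrite estimate_relax; apply: le_trans (ler_normD _ _) _.
rewrite (normrM (1 - _)) (normrM (step (i, x) n)) (ger0_norm s0).
rewrite (@ger0_norm _ (1 - _)) ?subr_ge0//.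
apply: le_trans
  (_ : (1 - step (i, x) n) * B + step (i, x) n * B <= _); last first.
  by rewrite -mulrDl subrK mul1r.
apply: lerD; rewrite ler_wpM2l ?subr_ge0//.
apply: le_trans hB; apply: le_trans (ler_normD _ _) _; apply: lerD => //.
rewrite normrM (ger0_norm (ltW g0)) ler_wpM2l ?(ltW g0)//.
apply: le_trans (ler_normB _ _) _; apply: lerD => //.
by rewrite ger0_norm ?sqrtr_ge0.
Qed.

Lemma greedy_value_bounded : exists B, forall n s, `|V n s w| <= B.
Proof.
have [B hB] := estimate_bounded; exists B => n s.
by apply: (maxf_norm_le a0) => a; apply: mean_norm_le => i; exact: hB.
Qed.

(** The bound on [V] depends on the path, which is why [transform_cvg] takes its square-summability
    path by path. *)
Lemma weighted_alpha_sqr_bounded x t :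
  (exists K : R, forall n, \sum_(0 <= k < n) alpha k x w ^+ 2 <= K) ->
  exists K : R, forall n, \sum_(0 <= k < n) (alpha k x w * V k t w) ^+ 2 <= K.
Proof.
move=> [K hK]; have [B hB] := greedy_value_bounded.
exists (K * B ^+ 2) => n.
apply: (@le_trans _ _
  (\sum_(0 <= k < n) (alpha k x w ^+ 2 * B ^+ 2))).
  apply: ler_sum => k _; rewrite exprMn ler_wpM2l ?sqr_ge0//.
  rewrite -[leLHS]real_normK ?num_real// ler_pXn2r ?nnegrE//.
  exact: le_trans (hB k t).
by rewrite -mulr_suml ler_wpM2r ?sqr_ge0.
Qed.

Hypothesis alpha_div : forall x, diverges (fun n => alpha n x w).
Hypothesis draws_cvg : forall i x,
  cvgn (fun n => \sum_(0 <= k < n) alpha k x w *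
    (\1_(draws beta k i) w - N%:R^-1 * \1_[set: Omega] w)).

(** The sum of the steps differs from [N^-1] times the sum of [alpha] by a convergent, hence
    bounded, series. The threshold for [alpha] allows for both the factor [N] and this bound. *)
Lemma step_div j : diverges (step j).
Proof.
case: j => i x K.
have [M [_ hM]] := cvg_seq_bounded (@draws_cvg i x).
have [n hn] := alpha_div x (N%:R * (K + (M + 1))).
exists n.
have h : `|\sum_(0 <= k < n) alpha k x w *
    (\1_(draws beta k i) w - N%:R^-1 * \1_[set: Omega] w)| <= M + 1.
  by apply: (hM (M + 1)) => //; rewrite ltrDl.
have e : \sum_(0 <= k < n) alpha k x w *
    (\1_(draws beta k i) w - N%:R^-1 * \1_[set: Omega] w) =
    \sum_(0 <= k < n) step (i, x) k - N%:R^-1 * \sum_(0 <= k < n) alpha k x w.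
  rewrite mulr_sumr -sumrB; apply: eq_bigr => k _.
  by rewrite /step indicT/=; ring.
move: h; rewrite e ler_norml => /andP[h _].
have : K + (M + 1) <= N%:R^-1 * \sum_(0 <= k < n) alpha k x w.
  by rewrite ler_pdivlMl ?ltr0n.
lra.
Qed.

Context (P : S * A -> S -> R) (Qstar : S * A -> R).
Hypothesis P_kernel : is_kernel P.
Hypothesis QstarP : is_Qstar P r gamma Qstar.
Hypothesis jump_cvg : forall i x t,
  cvgn (fun n => \sum_(0 <= k < n) alpha k x w * V k t w *
    (\1_(visit Sn An k x `&` draws beta k i `&` Sn k.+1 @^-1` [set t]) w -
     P x t * \1_(visit Sn An k x `&` draws beta k i) w)).

(** Centered by the kernel at the fixed [x], which is the visited pair whenever the step of [x] is
    nonzero. *)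
Definition jump_noise (x : S * A) n : R :=
  gamma * (V n (Sn n.+1 w) w - \sum_t P x t * V n t w).

Lemma jump_noise_step_cvg j :
  cvgn (fun n => \sum_(0 <= k < n) step j k * jump_noise j.2 k).
Proof.
case: j => i x /=.
have -> : (fun n => \sum_(0 <= k < n) step (i, x) k * jump_noise x k) =
    (fun n => gamma * \sum_t \sum_(0 <= k < n) alpha k x w * V k t w *
    (\1_(visit Sn An k x `&` draws beta k i `&` Sn k.+1 @^-1` [set t]) w -
     P x t * \1_(visit Sn An k x `&` draws beta k i) w)).
  apply/funext => n; rewrite exchange_big/= mulr_sumr; apply: eq_bigr => k _.
  rewrite /step /jump_noise /=.
  have [xX|/alpha_off ->] := pselect (x = (Sn k w, An k w)); last first.
    by rewrite !mul0r big1 ?mulr0// => t _; rewrite !mul0r.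
  have vE : \1_(visit Sn An k x) w = 1 :> R by rewrite indicE mem_set.
  have VE : V k (Sn k.+1 w) w = \sum_t V k t w * \1_(Sn k.+1 @^-1` [set t]) w.
    rewrite (bigD1 (Sn k.+1 w))//= indicE mem_set// mulr1 big1 ?addr0// => s sS.
    by rewrite indicE memNset ?mulr0// => /= h; rewrite h eqxx in sS.
  rewrite VE -sumrB mulrCA; congr (_ * _); rewrite mulr_sumr.
  by apply: eq_bigr => t _; rewrite !indicI/= vE; ring.
apply: is_cvgMr.
elim: (index_enum S) => [|t s IH].
  by under eq_fun do rewrite big_nil; exact: is_cvg_cst.
by under eq_fun do rewrite big_cons; exact: is_cvgD.
Qed.

Lemma estimate_cvg i x : (fun n => q n i x w) @ \oo --> Qstar x.
Proof.
have /andP[g0 g1] := gamma01.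
pose D (j : 'I_N * (S * A)) n := q n j.1 j.2 w - Qstar j.2.
(* The mean drift: by the Bellman equation, the relaxation target minus [Qstar] is [g] plus
   [jump_noise] plus [eps]. *)
pose g (j : 'I_N * (S * A)) n := gamma *
  \sum_t P j.2 t * (V n t w - maxf (fun a => Qstar (t, a))).
pose eps (j : 'I_N * (S * A)) n := - (gamma * Num.sqrt (rho n)).
have [B hB] := estimate_bounded.
suff h : D (i, x) @ \oo --> 0.
  rewrite -[Qstar x]add0r.
  have -> : (fun n => q n i x w) = (fun n => D (i, x) n + Qstar x).
    by apply/funext => n; rewrite /D subrK.
  by apply: cvgD => //; exact: cvg_cst.
apply: (@async_contraction_cvg0 R _ step (fun j => jump_noise j.2) g eps D gamma
  (B + \sum_x `|Qstar x|)).
- by rewrite ltW.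
- exact: step01.
- exact: step_div.
- exact: jump_noise_step_cvg.
- move=> j; rewrite -oppr0 -[X in - X](mulr0 gamma); apply: cvgN.
  by apply: cvgMr; exact: sqrt_rho_cvg0.
- move=> [k y] n; apply: le_trans (ler_normB _ _) _; apply: lerD => //=.
  by rewrite (bigD1 y)//= lerDl sumr_ge0.
- move=> n C hC [k y]; rewrite /g normrM (ger0_norm (ltW g0)).
  rewrite ler_wpM2l ?(ltW g0)//; apply: le_trans (ler_norm_sum _ _ _) _.
  have [P0 P1] := P_kernel.
  rewrite -[leRHS]mul1r -(P1 y) mulr_suml; apply: ler_sum => t _.
  rewrite normrM (ger0_norm (P0 _ _)) ler_wpM2l//.
  apply: maxf_dist => // a.
  (* The greedy values couple all estimates through their mean, so the sup norm in the contraction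
     runs over pairs of an estimate and a state-action pair. *)
  have -> : qhat n (t, a) w - Qstar (t, a) = N%:R^-1 * \sum_l D (l, (t, a)) n.
    rewrite /D /= sumrB mulrBr /estimate_hat; congr (_ - _).
    rewrite sumr_const card_ord -(mulr_natl (Qstar _)) mulrA mulVf ?mul1r//.
    by rewrite pnatr_eq0 -lt0n.
  by apply: mean_norm_le => l; exact: hC.
- move=> [k y] n; rewrite /D /= estimate_relax /g /eps /jump_noise /=.
  have -> : \sum_t P y t * (V n t w - maxf (fun a => Qstar (t, a))) =
      \sum_t P y t * V n t w - \sum_t P y t * maxf (fun a => Qstar (t, a)).
    by rewrite -sumrB; apply: eq_bigr => t _; rewrite mulrBr.
  have := QstarP y; rewrite /bellman_op.
  move: (\sum_t P y t * maxf _) => m; move: (Qstar y) => Q ->; ring.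
Qed.

Lemma estimate_hat_cvg x : (fun n => qhat n x w) @ \oo --> Qstar x.
Proof.
have -> : Qstar x = N%:R^-1 * \sum_(i < N) Qstar x.
  rewrite sumr_const card_ord -(mulr_natl (Qstar x)) mulrA mulVf ?mul1r//.
  by rewrite pnatr_eq0 -lt0n.
apply: cvgMr.
elim: (index_enum 'I_N) => [|i s IH].
  by under eq_fun do rewrite big_nil; rewrite big_nil; exact: cvg_cst.
under eq_fun do rewrite big_cons; rewrite big_cons; apply: cvgD => //.
exact: estimate_cvg.
Qed.

End Pathwise.

(** * Extended series, entrywise limits and the conclusion *)

Lemma eseries_diverges (R : realType) (u : nat -> R) : (forall n, 0 <= u n) ->
  (\sum_(0 <= n <oo) (u n)%:E = +oo)%E -> diverges u.
Proof.
move=> u0 uoo K; apply: contrapT => h.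
have : (\sum_(0 <= n <oo) (u n)%:E <= K%:E)%E.
  apply: lime_le; first by apply: is_cvg_nneseries => n _ _; rewrite lee_fin.
  apply: nearW => n; rewrite sumEFin lee_fin leNgt; apply/negP => Kn.
  by apply: h; exists n; exact: ltW.
by rewrite uoo.
Qed.

Lemma eseries_bounded (R : realType) (u : nat -> R) : (forall n, 0 <= u n) ->
  (\sum_(0 <= n <oo) (u n)%:E < +oo)%E ->
  exists K, forall n, \sum_(0 <= k < n) u k <= K.
Proof.
move=> u0 uoo; exists (fine (\sum_(0 <= n <oo) (u n)%:E)%E) => n.
have s0 : (0 <= \sum_(0 <= n <oo) (u n)%:E)%E.
  by apply: nneseries_ge0 => k _ _; rewrite lee_fin.
rewrite -lee_fin fineK ?ge0_fin_numE// -sumEFin.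
by apply: nneseries_lim_ge => k _; rewrite lee_fin.
Qed.

Lemma cvg_cV (R : realType) (m : nat) (u : nat -> 'cV[R]_m) (v : 'cV[R]_m) :
  (forall k, (fun n => u n k 0) @ \oo --> v k 0) -> u @ \oo --> v.
Proof.
move=> uv; apply/cvgrPdist_le => e e0.
have : \forall n \near \oo, forall k, `|v k 0 - u n k 0| <= e.
  by apply: filter_forall => k; have /cvgrPdist_le := uv k; apply.
apply: filterS => n h; rewrite /Num.norm/= mx_normrE.
apply/bigmax_leP; split; first exact: ltW.
by move=> [k l] _ /=; rewrite ord1 !mxE.
Qed.

Unset Implicit Arguments.
Set Strict Implicit.
Set Printing Implicit Defensive.

Theorem theorem3p1 (R : realType) (S A : finType)
    (P : S * A -> S -> R) (r : S * A -> R) (gamma : R) (s0 : S)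
    (policy : S -> A -> R) (Qstar : S * A -> R)
    (d : measure_display) (Omega : measurableType d) (Pr : probability Omega R)
    (Sn : nat -> Omega -> S) (An : nat -> Omega -> A)
    (alpha : nat -> S * A -> Omega -> R) (rho : nat -> R) (N : nat)
    (beta : nat -> Omega -> 'rV[R]_N)
    (theta0 : 'I_N -> Omega -> 'cV[R]_#|{: S * A}|)
    (P_kernel : is_kernel P)
    (policy_kernel : is_kernel policy)
    (gamma01 : 0 < gamma < 1)
    (QstarP : is_Qstar P r gamma Qstar)
    (N_gt0 : (0 < N)%N)
    (Sn_rv : forall n, measurable_events (events_fin (Sn n)))
    (An_rv : forall n, measurable_events (events_fin (An n)))
    (alpha_rv : forall n x, measurable_events (events_real (alpha n x)))
    (beta_rv : forall n, measurable_events (events_mx (beta n)))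
    (theta0_rv : forall i, measurable_events (events_mx (theta0 i)))
    (S0E : forall w, Sn 0%N w = s0)
    (An_law : forall n,
      cond_law Pr (history Sn An n) (An n) (fun w => policy (Sn n w)))
    (Sn_law : forall n,
      cond_law Pr (Gfield Sn An alpha beta theta0 n) (Sn n.+1)
        (fun w => P (Sn n w, An n w)))
    (beta_law : forall n (i : 'I_N),
      Pr (beta n @^-1` [set delta_mx 0 i]) = (N%:R^-1)%:E)
    (beta_indep : independent_seq Pr (fun n => events_mx (beta n)))
    (beta_indep_past : forall n,
      independent_fields Pr (events_mx (beta n))
        (Gfield_next Sn An alpha beta theta0 n))
    (rho_ge0 : forall n, 0 <= rho n)
    (rho_cvg0 : rho @ \oo --> 0)
    (alphaP : {ae Pr, forall w, forall x,
      [/\ forall n, x = (Sn n w, An n w) -> 0 < alpha n x w <= 1,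
          forall n, x <> (Sn n w, An n w) -> alpha n x w = 0,
          (\sum_(0 <= n <oo) (alpha n x w)%:E = +oo)%E &
          (\sum_(0 <= n <oo) (alpha n x w ^+ 2)%:E < +oo)%E]})
    (r_bounded : exists M, forall x, `|r x| <= M) :
  {ae Pr, forall w,
    (fun n => (feature_mx tabular)^T *m
              theta_hat tabular r gamma rho Sn An alpha beta theta0 n w) @ \oo
      --> vec_of_fun Qstar}.
Proof.
(* The policy at [s0] sums to one, so there is an action; it anchors every maximum over actions. *)
have [a0 _] : exists a0 : A, True.
  case: (pickP (@predT A)) => [a _|A0]; first by exists a.
  have /eqP := policy_kernel.2 s0; rewrite big_pred0//.
  by rewrite eq_sym oner_eq0.
have hd := ae_draws Sn_rv An_rv alpha_rv beta_rv theta0_rv N_gt0 beta_law.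
have hc : {ae Pr, forall w, forall i x, (exists K : R, forall n,
      \sum_(0 <= k < n) alpha k x w ^+ 2 <= K) ->
    cvgn (fun n => \sum_(0 <= k < n) alpha k x w *
      (\1_(draws beta k i) w - N%:R^-1 * \1_[set: Omega] w))}.
  apply: filter_forall => i; apply: filter_forall => x.
  exact: draws_noise_cvg.
have hj : {ae Pr, forall w, forall i x t, (exists K : R, forall n,
      \sum_(0 <= k < n) (alpha k x w *
        greedy_value r gamma rho Sn An alpha beta theta0 k t w) ^+ 2 <= K) ->
    cvgn (fun n => \sum_(0 <= k < n) alpha k x w *
      greedy_value r gamma rho Sn An alpha beta theta0 k t w *
      (\1_(visit Sn An k x `&` draws beta k i `&` Sn k.+1 @^-1` [set t]) w -
       P x t * \1_(visit Sn An k x `&` draws beta k i) w))}.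
  apply: filter_forall => i; apply: filter_forall => x.
  by apply: filter_forall => t; apply: jump_noise_cvg.
(* All randomness is spent here; the rest is deterministic along one path. *)
apply: (filterS _ (filterI (filterI alphaP hd) (filterI hc hj))).
move=> w [[ha hdw] [hcw hjw]].
under eq_fun do rewrite feature_mx_tabular.
have alpha_visit n x : x = (Sn n w, An n w) -> 0 < alpha n x w <= 1.
  by have [h _ _ _] := ha x; exact: h.
have alpha_off n x : x <> (Sn n w, An n w) -> alpha n x w = 0.
  by have [_ h _ _] := ha x; exact: h.
have alpha_ge0 n x : 0 <= alpha n x w.
  by have /andP[] := alpha01 alpha_visit alpha_off n x.
have alpha_sqr x : exists K : R, forall n,
    \sum_(0 <= k < n) alpha k x w ^+ 2 <= K.
  have [_ _ _ h] := ha x.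
  by apply: eseries_bounded h => n; exact: sqr_ge0.
apply: cvg_cV => k; rewrite -(enum_valK k) mxE enum_rankK.
under eq_fun do rewrite theta_hatE.
apply: (estimate_hat_cvg rho_ge0 rho_cvg0 gamma01 N_gt0 a0 alpha_visit alpha_off
  hdw _ _ P_kernel QstarP).
- by move=> x; have [_ _ h _] := ha x; exact: eseries_diverges h.
- by move=> i x; exact: hcw.
- move=> i x t; apply: hjw.
  exact: (weighted_alpha_sqr_bounded r _ rho_ge0 rho_cvg0 gamma01 N_gt0 a0
    alpha_visit alpha_off hdw).
Qed.
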